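(* Fix $c_0>0$. There is a constant $C>0$ depending only on $c_0$ such that the following holds. Let $q_{\mathrm{data}}=q_0$ be a distribution on $[S]^d$, $0<\delta<T$, and $0=t_0<t_1<\dots<t_N=T-\delta$ with $h_k:=t_k-t_{k-1}\le\kappa\min(1,T-t_k)$ for $k\in[N]$, where $\kappa\le c_0$. Assume positive score estimates satisfy the (masking) approximation-error assumption with parameter $\varepsilon_{\mathrm{score}}$. Let $p_0=((1-e^{-T})\delta_{\mathrm{MASK}}+S^{-1}e^{-T}\sum_{a=1}^S\delta_a)^{\otimes d}$ and let $p_{\mathrm{output}}=p_{T-\delta}$ be the law of the output of truncated $\tau$-leaping initialized at $p_0$. Then $$\mathsf{KL}(q_\delta\,\|\,p_{\mathrm{output}})\le C\Big(\varepsilon_{\mathrm{score}}+e^{-T}d\log S+\sum_{k=0}^{N-1}h_{k+1}\int_{T-t_{k+1}}^{T-t_k}\mathcal I(t)\,dt+\kappa^3Nd+\kappa\,\mathsf C\Big),$$ where $$\mathsf C:=\sum_{k=0}^{N-1}(t_{k+1}-t_k)\,\mathbb E_{x\sim q_{T-t_k}}\sum_{i\in m(x)}\sum_{c\in[S]}s_{T-t_k}(x\odot_ic,x)\Big|\log\frac{\hat s_{T-t_k}(x\odot_ic,x)}{s_{T-t_k}(x\odot_ic,x)}\Big|.$$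
   Context: Masking noising process on $\mathcal X=([S]\cup\{\mathrm{MASK}\})^d$ from $q_0$ on $[S]^d$: CTMC with rate $Q(x,x\odot_i\mathrm{MASK})=1$ for each $i\notin m(x)$ and $0$ for other off-diagonal transitions; $q_t$ its time-$t$ law; $m(x)$ the set of masked coordinates of $x$; $x\odot_i c$ is $x$ with coordinate $i$ set to $c$; $s_t(y,x)=q_t(y)/q_t(x)$. $D(a,b)=a/b-1-\log(a/b)$, $\mathcal L_{\mathrm{SE}}(t,\hat s,s)=\mathbb E_{x\sim q_t}[\sum_{y\neq x}Q(y,x)s(y,x)D(\hat s(y,x),s(y,x))]$; approximation-error assumption: $\sum_{k=0}^{N-1}(t_{k+1}-t_k)\mathcal L_{\mathrm{SE}}(T-t_k,\hat s_{T-t_k},s_{T-t_k})\le\varepsilon_{\mathrm{score}}$ with $\hat s_{T-t_k}>0$. $\mathcal I(t)=\sum_{i\neq j}\mathrm I(x_t^i;x_t^j\mid(x_t^k)_{k\notin\{i,j\}})$, $x_t\sim q_t$. Truncated $\tau$-leaping: $x_{t_0}\sim p_0$; for each $k$, unmasked coordinates of $x_{t_k}$ are kept, and independently each masked coordinate $i$ of $x_{t_k}$ evolves on $[t_k,t_{k+1}]$ with constant rate $\hat s_{T-t_k}(x_{t_k}\odot_i b,x_{t_k})$ of jumping from MASK to $b\in[S]$ and no further transitions once unmasked; i.e. it stays MASK with probability $\exp(-(t_{k+1}-t_k)\Lambda)$, $\Lambda=\sum_{b}\hat s_{T-t_k}(x_{t_k}\odot_i b,x_{t_k})$, and otherwise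 becomes $b$ with probability proportional to $\hat s_{T-t_k}(x_{t_k}\odot_ib,x_{t_k})$. $p_{T-\delta}$ is the law of $x_{t_N}$. *)

(* Defs.v *)
From HB Require Import structures.
From mathcomp Require Import all_boot all_order all_algebra.
From mathcomp Require Import all_classical all_reals all_analysis.
Set Implicit Arguments. Unset Strict Implicit. Unset Printing Implicit Defensive.
Import Order.TTheory GRing.Theory Num.Theory.
Local Open Scope ring_scope.

Section MaskingDiffusion.
Variables (R : realType) (S d : nat).

(* Masked state space ([S] \cup {MASK})^d ; MASK is encoded as None,
   the letter a in [S] as Some a. *)
Definition state := {ffun 'I_d -> option 'I_S}.
Definition clean := {ffun 'I_d -> 'I_S}.

Definition setc (x : state) (i : 'I_d) (c : option 'I_S) : state :=
  [ffun j => if j == i then c else x j].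

Definition masked (x : state) : {set 'I_d} := [set i | x i == None].

(* Generator Q(x,y) of the forward masking CTMC, off-diagonal part:
   rate 1 for x -> x \odot_i MASK with i unmasked in x, 0 otherwise. *)
Definition Qgen (x y : state) : R :=
  if [exists i, (i \notin masked x) && (y == setc x i None)] then 1 else 0.

(* Transition probability of one coordinate of the masking process during
   time t, from the clean letter a: stays a w.p. e^{-t}, is masked w.p.
   1 - e^{-t} (this is exp(tQ) for the one-coordinate generator). *)
Definition fwd1 (t : R) (a : 'I_S) (b : option 'I_S) : R :=
  if b == Some a then expR (- t) else if b == None then 1 - expR (- t) else 0.

(* q_t : time-t law of the masking process started from q0 on [S]^d
   (coordinates are masked independently). *)
Definition qt (q0 : clean -> R) (t : R) (y : state) : R :=
  \sum_(x : clean) q0 x * \prod_(i < d) fwd1 t (x i) (y i).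

Definition score (q0 : clean -> R) (t : R) (y x : state) : R :=
  qt q0 t y / qt q0 t x.

Definition Dfun (a b : R) : R := a / b - 1 - ln (a / b).

(* b * D(a,b), extended continuously to b = 0 (value a) *)
Definition sD (a b : R) : R := if 0 < b then b * Dfun a b else a.

Definition L_SE (q0 : clean -> R) (t : R) (shat : state -> state -> R) : R :=
  \sum_(x : state) qt q0 t x *
    \sum_(y : state | y != x) Qgen y x * sD (shat y x) (score q0 t y x).

Definition marg (p : state -> R) (A : {set 'I_d}) (x : state) : R :=
  \sum_(y : state | [forall j, (j \notin A) ==> (y j == x j)]) p y.

(* conditional mutual information I(x^i ; x^j | (x^k)_{k \notin {i,j}}),
   x ~ p *)
Definition cmi (p : state -> R) (i j : 'I_d) : R :=
  \sum_(x : state) p x *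
    ln (p x * marg p [set i; j] x / (marg p [set j] x * marg p [set i] x)).

Definition Itot (q0 : clean -> R) (t : R) : R :=
  \sum_(i < d) \sum_(j < d | j != i) cmi (qt q0 t) i j.

Definition Lam (sh : state -> state -> R) (x : state) (i : 'I_d) : R :=
  \sum_(b : 'I_S) sh (setc x i (Some b)) x.

Definition step1 (h : R) (sh : state -> state -> R) (x : state) (i : 'I_d)
    (c : option 'I_S) : R :=
  match x i with
  | Some a => if c == Some a then 1 else 0
  | None =>
      match c with
      | None => expR (- (h * Lam sh x i))
      | Some b => (1 - expR (- (h * Lam sh x i))) *
                  (sh (setc x i (Some b)) x / Lam sh x i)
      end
  end.

Definition kernel (h : R) (sh : state -> state -> R) (x y : state) : R :=
  \prod_(i < d) step1 h sh x i (y i).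

Definition p0 (T : R) (x : state) : R :=
  \prod_(i < d) (if x i is None then 1 - expR (- T) else expR (- T) / S%:R).

(* law of x_{t_k}; the step from t_k to t_{k+1} uses shat k = \hat s_{T-t_k} *)
Fixpoint plaw (T : R) (t : nat -> R) (shat : nat -> state -> state -> R)
    (k : nat) : state -> R :=
  match k with
  | 0%N => p0 T
  | k'.+1 => fun y => \sum_(x : state)
              plaw T t shat k' x * kernel (t k'.+1 - t k') (shat k') x y
  end.

Definition KL (q p : state -> R) : \bar R :=
  if [exists x, (0 < q x) && (p x == 0)] then +oo%E
  else (\sum_(x : state) q x * ln (q x / p x))%:E.

Definition Cterm (q0 : clean -> R) (T : R) (t : nat -> R)
    (shat : nat -> state -> state -> R) (N : nat) : R :=
  \sum_(k < N) (t k.+1 - t k) *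
    \sum_(x : state) qt q0 (T - t k) x *
      \sum_(i in masked x) \sum_(c : 'I_S)
        score q0 (T - t k) (setc x i (Some c)) x *
        `| ln (shat k (setc x i (Some c)) x /
               score q0 (T - t k) (setc x i (Some c)) x) |.

End MaskingDiffusion.

(* Main.v *)
Require Import Defs.
From HB Require Import structures.
From mathcomp Require Import all_boot all_order all_algebra.
From mathcomp Require Import all_classical all_reals all_analysis.
From mathcomp Require Import ring lra.
Set Implicit Arguments. Unset Strict Implicit. Unset Printing Implicit Defensive.
Import Order.TTheory GRing.Theory Num.Theory.
Import numFieldNormedType.Exports.
Local Open Scope ring_scope.

(** The chain rule for KL bounds KL(q_delta || p_output) by KL(q_T || p_0), at
    most e^{-T} d log S, plus for every step the mean KL divergence between the
    true reverse transition from time tau = T - t_k to sigma = T - t_{k+1} and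
    the tau-leaping kernel.  A masked configuration is a clean word together
    with a random set V of visible coordinates, each visible with probability
    p = e^{-t}.  Let H(V) be the entropy of the visible part of the clean word
    and f(p) the expectation of H(V).  The step divergence splits in two parts.

    The first is the total correlation of the coordinates revealed in the step,
    f(p_tau) - f(p_sigma) + (p_sigma - p_tau) f'(p_tau).  Since
    I(t) = - p^2 f''(p) has the antiderivative p f'(p) - f(p), the tangent
    inequality for the concave function f at p_sigma says exactly that this is
    at most (e^h - 1) times the integral of I.

    The second compares, coordinate by coordinate, the true unmasking law with
    one jump of constant rate.  Expanding to third order in h, the first-order
    term is h L_SE, the second-order term is proportional to the sum over b of
    s_b - shat_b, which is at most sum_b s_b |log (shat_b / s_b)|, and the
    rest is O(kappa^3). *)

(** * Random subsets with independent coordinates, and derivatives in the inclusion probability *)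

Section RandomSubsets.
Variables (R : realType) (d : nat).
Implicit Types (p : R) (V : {set 'I_d}) (a : {set 'I_d} -> R) (i j : 'I_d).

Lemma sum_set_split i (F : {set 'I_d} -> R) :
  \sum_V F V = \sum_(V : {set 'I_d} | i \notin V) (F (i |: V) + F V).
Proof.
rewrite (bigID (fun V : {set 'I_d} => i \in V)) /= big_split /=; congr (_ + _).
rewrite (reindex_onto (fun V : {set 'I_d} => i |: V) (fun V => V :\ i)) /=; last first.
  by move=> V iV; rewrite finset.setD1K.
apply: eq_bigl => V; rewrite finset.setU11 /=; apply/eqP/idP => [<-|iV].
  by rewrite finset.setD11.
by rewrite finset.setU1K.
Qed.

(** The law of a subset that includes each coordinate independently with probability [p]. Later [p]
    is [expR (- t)] and [V] the set of visible coordinates. *)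
Definition wt p V : R := \prod_(i < d) (if i \in V then p else 1 - p).

Definition wt' p i V : R := \prod_(j < d | j != i) (if j \in V then p else 1 - p).

Lemma wtE p i V : wt p V = (if i \in V then p else 1 - p) * wt' p i V.
Proof. by rewrite /wt (bigD1 i). Qed.

Lemma wt'_eq p i V (W : {set 'I_d}) : (forall j, j != i -> (j \in V) = (j \in W)) ->
  wt' p i V = wt' p i W.
Proof. by move=> h; apply: eq_bigr => j ji; rewrite h. Qed.

Lemma wt'U p i V : wt' p i (i |: V) = wt' p i V.
Proof. by apply: wt'_eq => j ji; rewrite !inE (negbTE ji). Qed.

Definition Ew p a : R := \sum_V wt p V * a V.

Lemma Ew_eq p a b : a =1 b -> Ew p a = Ew p b.
Proof. by move=> ab; apply: eq_bigr => V _; rewrite ab. Qed.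

Lemma sum_wt p : \sum_V wt p V = 1.
Proof.
transitivity (\prod_(i < d) (p + (1 - p))); last first.
  by apply: big1 => i _; rewrite addrC subrK.
by rewrite bigA_distr.
Qed.

Lemma Ew_cst p (c : R) : Ew p (fun=> c) = c.
Proof. by rewrite /Ew -mulr_suml sum_wt mul1r. Qed.

Lemma EwZ p (c : R) a : Ew p (fun V => c * a V) = c * Ew p a.
Proof. by rewrite /Ew mulr_sumr; apply: eq_bigr => V _; rewrite mulrCA. Qed.

Lemma EwB p a b : Ew p (fun V => a V - b V) = Ew p a - Ew p b.
Proof. by rewrite /Ew -sumrB; apply: eq_bigr => V _; rewrite mulrBr. Qed.

Lemma EwN p a : Ew p (fun V => - a V) = - Ew p a.
Proof. by rewrite /Ew -sumrN; apply: eq_bigr => V _; rewrite mulrN. Qed.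

Lemma EwD p a b : Ew p (fun V => a V + b V) = Ew p a + Ew p b.
Proof. by rewrite /Ew -big_split; apply: eq_bigr => V _; rewrite mulrDr. Qed.

Lemma Ew_sum p (I : Type) (s : seq I) (P : pred I) (a : I -> {set 'I_d} -> R) :
  Ew p (fun V => \sum_(k <- s | P k) a k V) = \sum_(k <- s | P k) Ew p (a k).
Proof.
by rewrite /Ew exchange_big; apply: eq_bigr => V _; rewrite mulr_sumr.
Qed.

(** Conditioning on whether [i] is included. Both expectations on the right still run over all
    subsets, because their integrands no longer see [i]. *)
Lemma Ew_cond p i a :
  Ew p a = p * Ew p (fun V => a (i |: V)) + (1 - p) * Ew p (fun V => a (V :\ i)).
Proof.
rewrite /Ew !(sum_set_split i) !mulr_sumr -big_split /=.
apply: eq_bigr => V iV; rewrite !(wtE p i) !wt'U finset.setU11 (negbTE iV).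
rewrite finset.setUA finset.setUid finset.setU1K //.
have -> : V :\ i = V by apply/finset.setDidPl; rewrite disjoint_sym finset.disjoints1.
by ring.
Qed.

Lemma wt_ge0 p V : 0 <= p <= 1 -> 0 <= wt p V.
Proof. by move=> /andP[p0 p1]; apply: prodr_ge0 => i _; case: ifP; rewrite ?subr_ge0. Qed.

Lemma wt_gt0 p V : 0 < p < 1 -> 0 < wt p V.
Proof. by move=> /andP[p0 p1]; apply: prodr_gt0 => i _; case: ifP; rewrite ?subr_gt0. Qed.

Lemma le_Ew p a b : 0 <= p <= 1 -> (forall V, a V <= b V) -> Ew p a <= Ew p b.
Proof. by move=> hp ab; apply: ler_sum => V _; rewrite ler_wpM2l ?wt_ge0. Qed.

Lemma Ew_eq0 p a : (forall V, a V = 0) -> Ew p a = 0.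
Proof. by move=> a0; apply: big1 => V _; rewrite a0 mulr0. Qed.

Lemma Ew_ge0 p a : 0 <= p <= 1 -> (forall V, 0 <= a V) -> 0 <= Ew p a.
Proof. by move=> hp a0; apply: sumr_ge0 => V _; rewrite mulr_ge0 ?wt_ge0. Qed.

(** Discrete derivative along coordinate [i]; its value is the same for [V] with or without [i]. *)
Definition Del i a V : R := a (i |: V) - a (V :\ i).

Definition DelT a V : R := \sum_(i < d) Del i a V.

(** The right side is what the product rule yields when the factor of [wt] at [i] is differentiated
    in [p]. *)
Lemma Ew_Del p i a : Ew p (Del i a) =
  \sum_(V : {set 'I_d}) (if i \in V then 1 else -1) * wt' p i V * a V.
Proof.
rewrite /Ew !(sum_set_split i); apply: eq_bigr => V iV.
rewrite !(wtE p i) !wt'U finset.setU11 (negbTE iV) /Del.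
rewrite finset.setUA finset.setUid finset.setU1K //.
have -> : V :\ i = V by apply/finset.setDidPl; rewrite disjoint_sym finset.disjoints1.
by ring.
Qed.

Lemma Ew_DelT p a : Ew p (DelT a) = \sum_(i < d) Ew p (Del i a).
Proof. by rewrite -Ew_sum. Qed.

Lemma is_derive_wt p V : is_derive p (1 : R) (fun x => wt x V)
  (\sum_(i < d) (if i \in V then 1 else -1) * wt' p i V).
Proof.
rewrite /wt /wt'.
(* The product rule, by induction over a duplicate-free list: the head does not recur, so the filter
   [j != k] leaves the tail whole. *)
have key (s : seq 'I_d) : uniq s ->
  is_derive p (1 : R) (fun x => \prod_(i <- s) (if i \in V then x else 1 - x))
  (\sum_(i <- s) (if i \in V then 1 else -1) *
     \prod_(j <- s | j != i) (if j \in V then p else 1 - p)).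
  elim: s => [_|k s IH /= /andP[ks us]].
    rewrite big_nil.
    under [X in is_derive _ _ X _]eq_fun do rewrite big_nil.
    exact: is_derive_cst.
  rewrite big_cons.
  under [X in is_derive _ _ X _]eq_fun do rewrite big_cons.
  have hk : is_derive p (1 : R) (fun x => if k \in V then x else 1 - x)
      (if k \in V then 1 else -1).
    case: ifP => _; first exact: is_derive_id.
    apply: is_derive_eq. by rewrite add0r mul1r.
  have {}IH := IH us.
  apply: is_derive_eq.
  rewrite addrC /GRing.scale /= big_cons eqxx /=; congr (_ + _).
    rewrite mulrC; congr (_ * _); rewrite [RHS]big_seq_cond [LHS]big_seq.
    by apply: eq_bigl => j; case: eqVneq => [->|]; rewrite ?(negbTE ks) ?andbT.
  rewrite mulr_sumr [LHS]big_seq [RHS]big_seq; apply: eq_bigr => i iS.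
  rewrite big_cons; have -> : k != i by apply: contraNneq ks => ->.
  by rewrite mulrCA.
exact: (key _ (index_enum_uniq _)).
Qed.

(** Russo's formula. Applied twice, it gives the second derivative as the expectation of
    [DelT (DelT a)]. *)
Lemma is_derive_Ew p a : is_derive p (1 : R) (fun x => Ew x a) (Ew p (DelT a)).
Proof.
rewrite /Ew.
have h V : is_derive p (1 : R) (fun x => wt x V * a V)
   ((\sum_(i < d) (if i \in V then 1 else -1) * wt' p i V) * a V).
  have hw := is_derive_wt p V.
  apply: is_derive_eq.
  by rewrite scaler0 add0r /GRing.scale /= mulrC.
have -> : (fun x => \sum_V wt x V * a V) = \sum_V (fun x => wt x V * a V).
  by apply/funext => x; rewrite fct_sumE.
apply: is_derive_eq.
  apply: (big_ind2 (fun (F : R -> R) (D : R) => is_derive p 1 F D)).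
  - exact: (is_derive_cst (0 : R)).
  - by move=> F1 D1 F2 D2 h1 h2; exact: is_deriveD.
  - by move=> V _; exact: h.
rewrite -/(Ew p (DelT a)) Ew_DelT.
under [RHS]eq_bigr do rewrite Ew_Del.
by rewrite [RHS]exchange_big; apply: eq_bigr => V _; rewrite mulr_suml.
Qed.

End RandomSubsets.

(** * Consequences of the mean value theorem *)

Section MeanValue.
Local Open Scope classical_set_scope.
Local Open Scope ring_scope.
Variable R : realType.
Implicit Types (f df ddf : R -> R) (a b : R).

Lemma is_derive_within f df a b : (forall x, a <= x <= b -> is_derive x 1 f (df x)) ->
  {within `[a, b]%classic, continuous f}.
Proof.
move=> h; apply: derivable_within_continuous => x; rewrite in_itv /= => /h [].
by [].
Qed.

Lemma ge0_is_derive_le f df a b : a <= b ->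
  (forall x, a <= x <= b -> is_derive x 1 f (df x)) ->
  (forall x, a <= x <= b -> 0 <= df x) -> f a <= f b.
Proof.
move=> ab hd df0.
have hoo x : x \in `]a, b[ -> is_derive x 1 f (df x).
  by rewrite in_itv /= => /andP[/ltW ax /ltW xb]; apply: hd; rewrite ax.
have [c cab fE] := MVT_segment ab hoo (is_derive_within hd).
rewrite -subr_ge0 fE mulr_ge0 ?subr_ge0 //; apply: df0.
by move: cab; rewrite in_itv.
Qed.

(** The chord slope is [df c] for some [c] in the interval, and this is at least [df b] because [df]
    is nonincreasing. *)
Lemma concave_tangent f df ddf a b : a <= b ->
  (forall x, a <= x <= b -> is_derive x 1 f (df x)) ->
  (forall x, a <= x <= b -> is_derive x 1 df (ddf x)) ->
  (forall x, a <= x <= b -> ddf x <= 0) -> f a <= f b + df b * (a - b).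
Proof.
move=> ab hd hdd df0.
have hoo x : x \in `]a, b[ -> is_derive x 1 f (df x).
  by rewrite in_itv /= => /andP[/ltW ax /ltW xb]; apply: hd; rewrite ax.
have [c cab fE] := MVT_segment ab hoo (is_derive_within hd).
have : - df c <= - df b.
  move: cab; rewrite in_itv /= => /andP[ac cb].
  apply: (@ge0_is_derive_le (fun x => - df x) (fun x => - ddf x)) => // x /andP[cx xb].
    by apply: is_deriveN; apply: hdd; rewrite xb (le_trans ac).
  by rewrite oppr_ge0 df0 // xb (le_trans ac).
move=> ?; have -> : f a = f b - df c * (b - a) by rewrite -fE; ring.
by nra.
Qed.

End MeanValue.

(** * Scalar inequalities behind the cost of one coordinate *)

Section ScalarInequalities.
Variable R : realType.
Implicit Types (x u z h a m kappa G : R).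

Lemma ln_le_subr1 x : 0 < x -> ln x <= x - 1.
Proof.
move=> x0; have -> : ln x = ln (1 + (x - 1)) by congr ln; ring.
by apply: le_ln1Dx; lra.
Qed.

Lemma expR_sub_sinh_ge x : 0 <= x -> 2 * x <= expR x - expR (- x).
Proof.
move=> x0.
suff : expR 0 - expR (- 0) - 2 * 0 <= expR x - expR (- x) - 2 * x.
  by rewrite oppr0 subrr mulr0 subrr subr_ge0.
apply: (@ge0_is_derive_le _ (fun y => expR y - expR (- y) - 2 * y)
   (fun y => expR y + expR (- y) - 2)) => // y _.
  apply: is_derive_eq; rewrite /GRing.scale /=; ring.
rewrite subr_ge0 expRN; have ey : 0 < expR y := expR_gt0 y.
rewrite -subr_ge0.
have -> : expR y + (expR y)^-1 - 2 = (expR y - 1) ^+ 2 / expR y.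
  by field; rewrite gt_eqF.
by rewrite divr_ge0 ?sqr_ge0 ?ltW.
Qed.

(** After exponentiation this is [z <= expR (z / 2) - expR (- (z / 2))]. The bound is exact to first
    order in [z], so its product with a quantity of order [h] is exact to second order. *)
Lemma ln_div_1subexpRN z : 0 < z -> ln (z / (1 - expR (- z))) <= z / 2.
Proof.
move=> z0; have e1 : 0 < 1 - expR (- z) by rewrite subr_gt0 expR_lt1 oppr_lt0.
rewrite -[leRHS]expRK ler_ln ?posrE ?expR_gt0 ?divr_gt0 //.
rewrite ler_pdivrMr //.
have hz : 0 <= z / 2 by rewrite divr_ge0 // ltW.
have := expR_sub_sinh_ge hz.
have -> : 2 * (z / 2) = z by field.
move=> /le_trans; apply.
rewrite mulrBr mulr1 -expRD.
by have -> : z / 2 - z = - (z / 2) by field.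
Qed.

(** The function [(1 - y) * expR (y + y ^+ 2 / 2)] equals 1 at 0 and has derivative
    [- y ^+ 2 * expR (y + y ^+ 2 / 2)], so it stays at most 1 on the positive axis. *)
Lemma ln_1sub_le u : 0 <= u < 1 -> ln (1 - u) <= - u - u ^+ 2 / 2.
Proof.
move=> /andP[u0 u1].
rewrite -[leRHS]expRK ler_ln ?posrE ?expR_gt0 ?subr_gt0 //.
have -> : - u - u ^+ 2 / 2 = - (u + u ^+ 2 / 2) by ring.
rewrite expRN -[leRHS]mul1r ler_pdivlMr ?expR_gt0 //.
suff : - ((1 - 0) * expR (0 + (0 : R) ^+ 2 / 2)) <= - ((1 - u) * expR (u + u ^+ 2 / 2)).
  by rewrite lerN2 subr0 mul1r expr0n /= mul0r addr0 expR0.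
apply: (@ge0_is_derive_le _ (fun y => - ((1 - y) * expR (y + y ^+ 2 / 2)))
   (fun y => y ^+ 2 * expR (y + y ^+ 2 / 2))) => // y _.
  apply: is_derive_eq; rewrite /GRing.scale /=; by field.
by rewrite mulr_ge0 ?expR_ge0 ?sqr_ge0.
Qed.

Lemma expR_sub1_le h : expR h - 1 <= h * expR h.
Proof.
have := expR_ge1Dx (- h); rewrite expRN => H.
have eh : 0 < expR h := expR_gt0 h.
have : (1 - h) * expR h <= 1 by rewrite -ler_pdivlMr // div1r.
lra.
Qed.

Lemma sDE (s e : R) : 0 <= e -> 0 < s -> sD s e = s - e - e * ln (s / e).
Proof.
rewrite /sD /Dfun le_eqVlt => /predU1P[<-|e0] s0.
  by rewrite ltxx mul0r !subr0.
by rewrite e0; field; rewrite gt_eqF.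
Qed.

Lemma sD_ge0 (s e : R) : 0 <= e -> 0 < s -> 0 <= sD s e.
Proof.
rewrite /sD /Dfun le_eqVlt => /predU1P[<-|e0] s0; first by rewrite ltxx ltW.
by rewrite e0 mulr_ge0 ?(ltW e0) // subr_ge0 ln_le_subr1 // divr_gt0.
Qed.

(** The polynomial remainder of [marginal_step_le], with [g] for [(expR h - 1) / h] and [v] for
    [a * h]. Each summand is cubic because [v] and [g - 1] are both of order [kappa]. *)
Lemma step_poly_le (g v kappa G : R) : 0 <= v <= kappa -> 1 <= g <= G ->
  g - 1 <= kappa * G ->
  v * (g - 1) ^+ 2 + v ^+ 2 * g / 2 * (g - 1) + (v * g) ^+ 3 / 2
    <= 2 * G ^+ 3 * kappa ^+ 3.
Proof.
move=> /andP[v0 vk] /andP[g1 gG] gk.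
have k0 : 0 <= kappa by lra.
have G1 : 1 <= G by lra.
have GkG : kappa * G <= kappa * G ^+ 2.
  by rewrite ler_wpM2l // expr2 ler_peMr //; lra.
have e1 : v * (g - 1) ^+ 2 <= kappa ^+ 3 * G ^+ 2.
  have -> : kappa ^+ 3 * G ^+ 2 = kappa * (kappa * G) ^+ 2 by ring.
  by rewrite ler_pM ?sqr_ge0 // ler_pXn2r // nnegrE; nra.
have e2 : v ^+ 2 * g / 2 * (g - 1) <= kappa ^+ 3 * G ^+ 2 / 2.
  have -> : kappa ^+ 3 * G ^+ 2 / 2 = kappa ^+ 2 * G / 2 * (kappa * G) by field.
  have v2 : v ^+ 2 <= kappa ^+ 2 by rewrite ler_pXn2r // nnegrE.
  have v20 : 0 <= v ^+ 2 := sqr_ge0 v.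
  have vg : v ^+ 2 * g <= kappa ^+ 2 * G by rewrite ler_pM //; lra.
  have vg0 : 0 <= v ^+ 2 * g by rewrite mulr_ge0 //; lra.
  by rewrite ler_pM //; lra.
have e3 : (v * g) ^+ 3 <= kappa ^+ 3 * G ^+ 3.
  rewrite -exprMn ler_pXn2r // ?nnegrE ?mulr_ge0 //; try lra.
  by rewrite ler_pM //; lra.
have e4 : kappa ^+ 3 * G ^+ 2 <= kappa ^+ 3 * G ^+ 3.
  by rewrite ler_wpM2l ?exprn_ge0 // [leRHS]exprS ler_peMl ?exprn_ge0 //; lra.
lra.
Qed.

(** The left side is a KL divergence: the first law reveals [b] with probability
    [(expR h - 1) * e b] and otherwise stays masked, the second makes one jump with constant rates
    [s b] during time [h]. *)
Lemma marginal_step_le (I : finType) (s e : I -> R) a h kappa G :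
  0 < h -> h <= kappa -> 0 < a -> a * h <= kappa -> expR h <= G ->
  a * (expR h - 1) < 1 ->
  (forall b, 0 <= e b) -> \sum_b e b = a -> (forall b, 0 < s b) ->
  a * (expR h - 1) * ln ((expR h - 1) * (\sum_b s b) / (1 - expR (- (h * \sum_b s b))))
    - (expR h - 1) * (\sum_b e b * ln (s b / e b))
    + (1 - a * (expR h - 1)) * (ln (1 - a * (expR h - 1)) + h * \sum_b s b)
  <= h * (\sum_b sD (s b) (e b))
     + 2 * G ^+ 3 * (kappa * (h * \sum_b e b * `|ln (s b / e b)|) + kappa ^+ 3).
Proof.
move=> h0 hk a0 ahk eG u1 e0 ea s0.
set L := \sum_b s b; set m := expR h - 1; set u := a * m.
have {}u1 : u < 1 := u1.
set E := \sum_b _ * ln _; set A := \sum_b _ * `|_|; set D := \sum_b sD _ _.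
have DE : D = L - a - E.
  rewrite -[X in _ - X - _]ea /D /L /E -!sumrB; apply: eq_bigr => b _; exact: sDE.
have D0 : 0 <= D by apply: sumr_ge0 => b _; exact: sD_ge0.
have EA : - E <= A.
  rewrite /E /A -sumrN; apply: ler_sum => b _; rewrite -mulrN ler_wpM2l //.
  by rewrite -normrN ler_norm.
have L0 : 0 < L.
  have [b _|noI] := pickP (@predT I).
    by rewrite /L (bigD1 b) //= ltr_wpDr // sumr_ge0 // => c _; exact: ltW.
  by move: a0; rewrite -ea big_pred0 // ltxx.
have A0 : 0 <= A by apply: sumr_ge0 => b _; rewrite mulr_ge0.
set g := m / h.
have mE : m = h * g by rewrite /g mulrC divfK // gt_eqF.
have m0 : 0 < m by rewrite subr_gt0 expR_gt1.
have g1 : 1 <= g by rewrite /g ler_pdivlMr // mul1r /m lerBrDl expR_ge1Dx.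
have gG : g <= G.
  by rewrite /g ler_pdivrMr // mulrC (le_trans (expR_sub1_le h)) // ler_wpM2l // ltW.
have gk : g - 1 <= h * G.
  have : g <= expR h by rewrite /g ler_pdivrMr // mulrC expR_sub1_le.
  have := expR_sub1_le h; have : h * expR h <= h * G by rewrite ler_wpM2l // ltW.
  lra.
set v := a * h.
have v0 : 0 < v by rewrite mulr_gt0.
have uE : u = v * g by rewrite /u mE mulrA.
have u0 : 0 < u by rewrite uE mulr_gt0 //; lra.
set z := h * L.
have z0 : 0 < z by rewrite mulr_gt0.
(* The ratio is [g] times [z / (1 - expR (- z))]; the first factor contributes at most [g - 1] and
   the second at most [z / 2]. *)
have lnE : ln (m * L / (1 - expR (- z))) <= (g - 1) + z / 2.
  have e1 : 0 < 1 - expR (- z) by rewrite subr_gt0 expR_lt1 oppr_lt0.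
  have -> : m * L / (1 - expR (- z)) = g * (z / (1 - expR (- z))).
    by rewrite mE /z; field; rewrite gt_eqF.
  rewrite lnM ?posrE ?divr_gt0 //.
  by rewrite lerD ?ln_div_1subexpRN // ln_le_subr1 // divr_gt0.
have ulnE : u * ln (m * L / (1 - expR (- z))) <= u * ((g - 1) + z / 2).
  by rewrite ler_wpM2l // ltW.
have u1ln : (1 - u) * ln (1 - u) <= (1 - u) * (- u - u ^+ 2 / 2).
  by rewrite ler_wpM2l ?subr_ge0 ?(ltW u1) // ln_1sub_le // u1 (ltW u0).
have G1 : 1 <= G by apply: le_trans eG; rewrite -expR0 ler_expR ltW.
have kG : 0 <= kappa * G by apply: mulr_ge0; lra.
have hgk : g - 1 <= kappa * G by apply: le_trans gk _; rewrite ler_wpM2r //; lra.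
have poly : v * (g - 1) ^+ 2 + v ^+ 2 * g / 2 * (g - 1) + (v * g) ^+ 3 / 2
    <= 2 * G ^+ 3 * kappa ^+ 3.
  by apply: step_poly_le => //; rewrite ?(ltW v0) ?ahk // g1.
have hA : 0 <= h * A by rewrite mulr_ge0 // ltW.
(* Trading the factor [m] of [E] for [h] costs [(m - h) * E], and [m - h] is of order
   [kappa * h]. *)
have t1 : - ((m - h) * E) <= kappa * G * (h * A).
  have -> : (m - h) * E = (g - 1) * (h * E) by rewrite mE; ring.
  rewrite -mulrN -mulrN; apply: (@le_trans _ _ ((g - 1) * (h * A))).
    by rewrite ler_wpM2l ?subr_ge0 // ler_wpM2l // (ltW h0).
  by rewrite ler_wpM2r.
(* Here [a - L] equals [- E - D], which is at most [A] since [D] is nonnegative. So the logarithmic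
   errors control the gap between the total rates. *)
have t2 : u / 2 * (v - z) <= kappa * G / 2 * (h * A).
  have vz : v - z <= h * A.
    have -> : v - z = h * (a - L) by rewrite /v /z; ring.
    by rewrite ler_wpM2l ?(ltW h0) //; lra.
  apply: (@le_trans _ _ (u / 2 * (h * A))).
    by rewrite ler_wpM2l // divr_ge0 // ltW.
  rewrite ler_wpM2r // ler_wpM2r // uE.
  by rewrite ler_pM //; lra.
have t3 : kappa * G * (h * A) <= kappa * G ^+ 3 * (h * A).
  rewrite ler_wpM2r // ler_wpM2l //; first lra.
  by rewrite exprS ler_peMr ?expr_ge1 //; lra.
have t4 : 0 <= kappa * G * (h * A) by rewrite mulr_ge0.
apply: le_trans
  (_ : u * ((g - 1) + z / 2) - m * E + (1 - u) * (- u - u ^+ 2 / 2) + (1 - u) * z <= _).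
  by rewrite -/z mulrDr; lra.
(* With the logarithms replaced by polynomials, an exact identity remains: score loss, two
   second-order errors, cubic remainder. *)
have -> : u * (g - 1 + z / 2) - m * E + (1 - u) * (- u - u ^+ 2 / 2) + (1 - u) * z
  = h * D + (- ((m - h) * E)) + u / 2 * (v - z)
    + (v * (g - 1) ^+ 2 + v ^+ 2 * g / 2 * (g - 1) + (v * g) ^+ 3 / 2).
  by rewrite DE uE /z /v; field.
have -> : 2 * G ^+ 3 * (kappa * (h * A) + kappa ^+ 3)
  = 2 * (kappa * G ^+ 3 * (h * A)) + 2 * G ^+ 3 * kappa ^+ 3 by ring.
lra.
Qed.

End ScalarInequalities.

(** * Entropy of the visible part of the clean word and its submodularity *)

Section SubsetEntropy.
Variables (R : realType) (S d : nat) (q0 : clean S d -> R).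
Hypothesis q0_ge0 : forall z, 0 <= q0 z.
Hypothesis q0_sum : \sum_z q0 z = 1.
Implicit Types (V W : {set 'I_d}) (z y : clean S d) (i j : 'I_d) (b : 'I_S).

Definition agree V z y := [forall j, (j \in V) ==> (y j == z j)].

Lemma agreeP V z y : reflect (forall j, j \in V -> y j = z j) (agree V z y).
Proof.
apply: (iffP forallP) => [h j jV|h j]; first by apply/eqP; have := h j; rewrite jV.
by apply/implyP => jV; rewrite h.
Qed.

Lemma agree_refl V z : agree V z z. Proof. exact/agreeP. Qed.

Lemma agree_sym V z y : agree V z y = agree V y z.
Proof. by apply/agreeP/agreeP => h j jV; rewrite h. Qed.

Lemma agree_trans V z y x : agree V z y -> agree V y x -> agree V z x.
Proof. by move=> /agreeP h1 /agreeP h2; apply/agreeP => j jV; rewrite h2 ?h1. Qed.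

Lemma agree_sub V W z y : V \subset W -> agree W z y -> agree V z y.
Proof. by move=> /fintype.subsetP VW /agreeP h; apply/agreeP => j /VW /h. Qed.

Definition mar V z : R := \sum_(y | agree V z y) q0 y.

Lemma mar_eq V z y : agree V z y -> mar V z = mar V y.
Proof.
move=> zy; apply: eq_bigl => x; apply/idP/idP; last exact: agree_trans.
by apply: agree_trans; rewrite agree_sym.
Qed.

Lemma mar_ge0 V z : 0 <= mar V z. Proof. exact: sumr_ge0. Qed.

Lemma mar_sub V W z : V \subset W -> mar W z <= mar V z.
Proof.
move=> VW; rewrite /mar [leLHS]big_mkcond [leRHS]big_mkcond; apply: ler_sum => y _.
by case: ifP => [/(agree_sub VW) ->//|_]; case: ifP.
Qed.

Lemma mar_le1 V z : mar V z <= 1.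
Proof.
rewrite -q0_sum /mar big_mkcond; apply: ler_sum => y _; by case: ifP.
Qed.

Lemma mar_gt0 V z : 0 < q0 z -> 0 < mar V z.
Proof.
move=> qz; rewrite /mar (bigD1 z) ?agree_refl //=.
by rewrite ltr_wpDr // sumr_ge0.
Qed.

(** Shannon entropy of the restriction to [V] of a word drawn from [q0]. Averaging over whole words
    avoids a separate type of partial words. *)
Definition ent V : R := - \sum_z q0 z * ln (mar V z).

Definition setz z i b : clean S d := [ffun j => if j == i then b else z j].

Lemma setz_id z i : setz z i (z i) = z.
Proof. by apply/ffunP => j; rewrite ffunE; case: eqVneq => [->|]. Qed.

Lemma agree_setz W z i b y : i \notin W ->
  agree (i |: W) (setz z i b) y = agree W z y && (y i == b).
Proof.
move=> iW; apply/agreeP/andP => [h|[/agreeP h /eqP yb] j].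
  split; last by rewrite h ?finset.setU11 // ffunE eqxx.
  apply/agreeP => j jW; rewrite h ?finset.in_setU1 ?jW ?orbT // ffunE.
  by case: eqVneq jW iW => [-> ->|].
by rewrite finset.in_setU1 ffunE; case: eqVneq => [->|_ /h].
Qed.

(** For [i] outside [W], the conditional law of the letter at [i] given the letters of [z] on
    [W]. *)
Definition cmar W i z b : R := mar (i |: W) (setz z i b) / mar W z.

Lemma cmar_agree W i z y b : agree W z y -> cmar W i z b = cmar W i y b.
Proof.
move=> zy; rewrite /cmar (mar_eq zy); congr (_ / _); apply: mar_eq.
apply/agreeP => k; rewrite finset.in_setU1 !ffunE.
by case: eqVneq => //= _ kW; move/agreeP: zy => ->.
Qed.

Lemma cmar_ge0 W i z b : 0 <= cmar W i z b.
Proof. by rewrite divr_ge0 ?mar_ge0. Qed.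

Lemma sum_cmar W i z (F : 'I_S -> R) : i \notin W ->
  \sum_b cmar W i z b * F b = (\sum_(y | agree W z y) q0 y * F (y i)) / mar W z.
Proof.
move=> iW; rewrite mulr_suml (partition_big (fun y => y i) predT) //=.
apply: eq_bigr => b _; rewrite /cmar /mar -mulrA mulr_suml.
apply: eq_big => [y|y]; first by rewrite agree_setz.
by rewrite agree_setz // => /andP[_ /eqP <-]; rewrite -mulrA (mulrC (F _)).
Qed.

Lemma sum_cmar1 W i z : i \notin W -> 0 < mar W z -> \sum_b cmar W i z b = 1.
Proof.
move=> iW m0; rewrite -[LHS](eq_bigr _ (fun b _ => mulr1 (cmar W i z b))).
rewrite sum_cmar //; under eq_bigr do rewrite mulr1.
by rewrite divff // gt_eqF.
Qed.

(** Tower property: [F] sees [z] only through [W], so the letter at [i] may be averaged under its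
    conditional law given [W]. *)
Lemma cmar_conv W i (F : clean S d -> 'I_S -> R) : i \notin W ->
  (forall z y b, agree W z y -> F z b = F y b) ->
  \sum_z q0 z * F z (z i) = \sum_z q0 z * \sum_b cmar W i z b * F z b.
Proof.
move=> iW FW; under [RHS]eq_bigr do rewrite sum_cmar // mulr_suml mulr_sumr.
rewrite [RHS](exchange_big_dep predT) //=; apply: eq_bigr => y _.
transitivity (\sum_(z | agree W y z) q0 z * (q0 y * F y (y i) / mar W y)).
  rewrite -mulr_suml -/(mar W y); have := q0_ge0 y.
  rewrite le_eqVlt => /predU1P[<-|qy]; first by rewrite !mul0r mulr0.
  by rewrite [RHS]mulrC divfK // gt_eqF // mar_gt0.
apply: eq_big => [z|z yz]; first exact: agree_sym.
by rewrite (mar_eq yz) (FW z y) // agree_sym.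
Qed.

Lemma mul_ln_div_le (x y : R) : 0 <= x -> 0 <= y -> (0 < x -> 0 < y) ->
  x * ln (y / x) <= y - x.
Proof.
rewrite le_eqVlt => /predU1P[<- y0 _|x0 _ /(_ x0) y0].
  by rewrite mul0r subr0.
have -> : y - x = x * (y / x - 1) by field; rewrite gt_eqF.
by rewrite ler_wpM2l ?(ltW x0) // ln_le_subr1 // divr_gt0.
Qed.

Lemma q0_gt0P z : q0 z = 0 \/ 0 < q0 z.
Proof. by have := q0_ge0 z; rewrite le_eqVlt => /predU1P[<-|]; [left|right]. Qed.

(** The left side is minus the conditional mutual information of the letters [i] and [j] given
    [W]. *)
Lemma ent_submodular W i j : i != j -> i \notin W -> j \notin W ->
  ent (i |: (j |: W)) - ent (j |: W) - ent (i |: W) + ent W <= 0.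
Proof.
move=> ij iW jW; set W' := j |: W.
have iW' : i \notin W' by rewrite finset.in_setU1 negb_or ij.
have WW' : W \subset W' by exact: finset.subsetUr.
pose F z b := ln (cmar W i z b / cmar W' i z b).
have FW z y b : agree W' z y -> F z b = F y b.
  by move=> zy; rewrite /F (cmar_agree _ _ zy) (cmar_agree _ _ (agree_sub WW' zy)).
have -> : ent (i |: W') - ent W' - ent (i |: W) + ent W = \sum_z q0 z * F z (z i).
  rewrite /ent -!sumrN -!big_split /=; apply: eq_bigr => z _.
  case: (q0_gt0P z) => [->|qz]; first by rewrite !mul0r !oppr0 !addr0.
  rewrite /F /cmar setz_id !ln_div ?posrE ?divr_gt0 ?mar_gt0 //; ring.
rewrite (cmar_conv iW' FW); apply: sumr_le0 => z _.
case: (q0_gt0P z) => [->|qz]; first by rewrite mul0r.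
apply: mulr_ge0_le0; first exact: ltW.
apply: (@le_trans _ _ (\sum_b (cmar W i z b - cmar W' i z b))); last first.
  by rewrite sumrB !sum_cmar1 ?mar_gt0 // subrr.
(* Gibbs' inequality letter by letter. Positivity passes from the finer conditional law to the
   coarser one because [mar] decreases in the set. *)
apply: ler_sum => b _; apply: mul_ln_div_le; rewrite ?cmar_ge0 //.
have m0 U : 0 < (mar U z)^-1 by rewrite invr_gt0 mar_gt0.
rewrite /cmar !(pmulr_lgt0 _ (m0 _)) => /lt_le_trans; apply.
by apply: mar_sub; apply: finset.setUS.
Qed.

Lemma Del2E (a : {set 'I_d} -> R) i j V : i != j ->
  let W := V :\ i :\ j in
  Del i (Del j a) V = a (i |: (j |: W)) - a (j |: W) - a (i |: W) + a W.
Proof.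
move=> ij /=; rewrite /Del.
have -> : j |: (i |: V) = i |: (j |: (V :\ i :\ j)).
  by apply/setP => k; rewrite !inE; case: (eqVneq k i); case: (eqVneq k j).
have -> : (i |: V) :\ j = i |: (V :\ i :\ j).
  apply/setP => k; rewrite !inE; case: (eqVneq k j) => [->|];
  by [rewrite eq_sym (negbTE ij)|case: (eqVneq k i)].
have -> : j |: V :\ i = j |: V :\ i :\ j.
  by apply/setP => k; rewrite !inE; case: (eqVneq k j).
by ring.
Qed.

Lemma Del_same (a : {set 'I_d} -> R) i V : Del i (Del i a) V = 0.
Proof.
rewrite /Del finset.setUA finset.setUid.
have -> : (i |: V) :\ i = V :\ i by apply/setP => k; rewrite !inE; case: (eqVneq k i).
have -> : i |: V :\ i = i |: V by apply/setP => k; rewrite !inE; case: (eqVneq k i).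
have -> : V :\ i :\ i = V :\ i by apply/setP => k; rewrite !inE; case: (eqVneq k i).
by ring.
Qed.

(** The diagonal terms vanish, since a difference along [i] no longer depends on [i]. *)
Lemma DelT2 (a : {set 'I_d} -> R) V :
  DelT (DelT a) V = \sum_(i < d) \sum_(j < d | j != i) Del i (Del j a) V.
Proof.
rewrite /DelT; apply: eq_bigr => i _.
rewrite [in RHS]big_mkcond /= {1}/Del -sumrB; apply: eq_bigr => j _.
by case: eqVneq => //= ->; rewrite -(Del_same a i V).
Qed.

(** By Russo's formula this makes the mean entropy of the visible part concave in the visibility
    [p]. *)
Lemma DelT2_ent_le0 V : DelT (DelT ent) V <= 0.
Proof.
rewrite DelT2; apply: sumr_le0 => i _; apply: sumr_le0 => j ji.
rewrite Del2E; last by rewrite eq_sym.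
by apply: ent_submodular; rewrite 1?eq_sym // !inE ?eqxx //= ?andbF.
Qed.

End SubsetEntropy.

(** * The masked law as a clean word with an independent random visible set *)

Section MaskedLaw.
Variables (R : realType) (S d : nat) (q0 : clean S d -> R).
Hypothesis q0_ge0 : forall z, 0 <= q0 z.
Hypothesis q0_sum : \sum_z q0 z = 1.
Implicit Types (V W A : {set 'I_d}) (z y : clean S d) (i j : 'I_d) (b : 'I_S)
  (x : state S d) (t p : R).

Definition reveal z V : state S d := [ffun i => if i \in V then Some (z i) else None].

Lemma masked_reveal z V i : (i \in masked (reveal z V)) = (i \notin V).
Proof. by rewrite inE ffunE; case: (i \in V). Qed.

Lemma reveal_eqE z y V W : (reveal z V == reveal y W) = (V == W) && agree V z y.
Proof.
apply/eqP/andP => [/ffunP h|[/eqP -> /agreeP h]]; last first.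
  by apply/ffunP => j; rewrite !ffunE; case: ifP => // /h ->.
split.
  apply/eqP/setP => j; have := h j; rewrite !ffunE.
  by case: (j \in V); case: (j \in W).
apply/agreeP => j jV; have := h j; rewrite !ffunE jV.
by case: ifP => // _ [].
Qed.

Lemma prodr_natr_forall (I : finType) (P : pred I) :
  \prod_k (P k)%:R = [forall k, P k]%:R :> R.
Proof.
case: forallP => h; first by apply: big1 => k _; rewrite h.
have [k Pk] : exists k : I, ~~ P k by apply/existsP; rewrite -negb_forall; apply/forallP.
by rewrite (bigD1 k) //= (negbTE Pk) mul0r.
Qed.

(** Each factor is a sum of a visible and a masked alternative; expanding the product enumerates the
    visible sets. *)
Lemma prod_fwd1 t z x : \prod_(i < d) fwd1 t (z i) (x i) =
  \sum_V wt (expR (- t)) V * (x == reveal z V)%:R.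
Proof.
set p := expR _.
transitivity (\prod_(i < d) ((if x i == Some (z i) then p else 0)
    + (if x i == None then 1 - p else 0))).
  apply: eq_bigr => i _; rewrite /fwd1.
  by case: (x i) => [c|]; case: eqP => //=; rewrite ?addr0 ?add0r.
rewrite bigA_distr; apply: eq_bigr => V _.
have -> : (x == reveal z V) = [forall i, x i == reveal z V i].
  by apply/eqP/forallP => [-> //|h]; apply/ffunP => i; apply/eqP.
rewrite -prodr_natr_forall -big_split /=; apply: eq_bigr => i _.
by rewrite ffunE; case: ifP => _; case: ifP => _; rewrite ?mulr1 ?mulr0.
Qed.

Lemma sum_qt t (g : state S d -> R) :
  \sum_x qt q0 t x * g x = \sum_z q0 z * Ew (expR (- t)) (fun V => g (reveal z V)).
Proof.
rewrite /qt; under eq_bigr do rewrite mulr_suml.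
rewrite exchange_big; apply: eq_bigr => z _.
under eq_bigr do rewrite -mulrA; rewrite -mulr_sumr; congr (_ * _).
under eq_bigr do rewrite prod_fwd1 mulr_suml.
rewrite exchange_big; apply: eq_bigr => V _.
rewrite (bigD1 (reveal z V)) //= eqxx mulr1 big1 ?addr0 // => x /negbTE ->.
by rewrite mulr0 mul0r.
Qed.

Lemma sum_q0_Ew p (g : clean S d -> {set 'I_d} -> R) :
  \sum_z q0 z * Ew p (g z) = Ew p (fun V => \sum_z q0 z * g z V).
Proof.
by rewrite Ew_sum; apply: eq_bigr => z _; rewrite EwZ.
Qed.

Lemma qt_pred t (P : pred (state S d)) : \sum_(x | P x) qt q0 t x =
  \sum_z q0 z * Ew (expR (- t)) (fun V => (P (reveal z V))%:R).
Proof.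
rewrite -(sum_qt t (fun x => (P x)%:R)) big_mkcond; apply: eq_bigr => x _.
by case: ifP; rewrite ?mulr1 ?mulr0.
Qed.

(** Off [A] the mask pattern is forced, on [A] it is summed out; the letters still constrained are
    those visible outside [A]. *)
Lemma marg_qt_reveal t A z V : let p := expR (- t) in
  marg (qt q0 t) A (reveal z V) =
  (\prod_(j < d | j \notin A) (if j \in V then p else 1 - p)) * mar q0 (V :\: A) z.
Proof.
move=> p; rewrite /marg qt_pred -/p.
pose c W := [forall j, (j \notin A) ==> ((j \in W) == (j \in V))].
have condE y W : [forall j, (j \notin A) ==> (reveal y W j == reveal z V j)]
    = c W && agree (V :\: A) z y.
  apply/forallP/andP => [h|[/forallP h1 /agreeP h2] j]; last first.
    apply/implyP => jA; have := h1 j; rewrite jA /= !ffunE => /eqP ->.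
    by case: ifP => // jV; rewrite h2 // !inE jA.
  split; first apply/forallP => j.
    apply/implyP => jA; have := h j; rewrite jA /= !ffunE.
    by case: (j \in W); case: (j \in V).
  apply/agreeP => j; rewrite !inE => /andP[jA jV]; have := h j.
  by rewrite jA /= !ffunE jV; case: ifP => // _ /eqP[].
transitivity (\sum_y q0 y * (Ew p (fun W => (c W)%:R) * (agree (V :\: A) z y)%:R)).
  apply: eq_bigr => y _; congr (_ * _); rewrite mulrC -EwZ; apply: Ew_eq => W.
  by rewrite condE -natrM mulnb andbC.
have -> : Ew p (fun W => (c W)%:R)
    = \prod_(j < d | j \notin A) (if j \in V then p else 1 - p).
  transitivity (\prod_(j < d) ((if (j \in A) || (j \in V) then p else 0)
     + (if (j \in A) || (j \notin V) then 1 - p else 0))); last first.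
    rewrite [RHS]big_mkcond; apply: eq_bigr => j _.
    by case: (j \in A); case: (j \in V); rewrite /= ?addr0 ?add0r // addrC subrK.
  rewrite bigA_distr; apply: eq_bigr => W _.
  rewrite /c -prodr_natr_forall -big_split /=; apply: eq_bigr => j _.
  by case: (j \in A); case: (j \in V); case: (j \in W); rewrite /= ?mulr1 ?mulr0.
rewrite /mar mulr_sumr [RHS]big_mkcond; apply: eq_bigr => y _.
by case: agree; rewrite ?mulr1 ?mulr0 // mulrC.
Qed.

Lemma qt_reveal t z V : qt q0 t (reveal z V) = wt (expR (- t)) V * mar q0 V z.
Proof.
have := marg_qt_reveal t finset.set0 z V; rewrite finset.setD0 /=.
have -> : \prod_(j < d | j \notin finset.set0)
   (if j \in V then expR (- t) else 1 - expR (- t)) = wt (expR (- t)) V.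
  by apply: eq_bigl => j; rewrite inE.
move=> <-; rewrite /marg (big_pred1 (reveal z V)) // => x.
apply/forallP/eqP => [h|-> j]; last by rewrite eqxx implybT.
by apply/ffunP => j; apply/eqP; have := h j; rewrite inE.
Qed.

Lemma expRN_lt1 t : 0 < t -> 0 < expR (- t) < 1.
Proof. by move=> t0; rewrite expR_gt0 expR_lt1 oppr_lt0. Qed.

(** The mask weights cancel inside the logarithm and leave marginals of [q0], hence the second
    difference [K] of the entropy. *)
Lemma cmi_qt t i j : 0 < t -> i != j ->
  cmi (qt q0 t) i j = - (expR (- t) ^+ 2 * Ew (expR (- t)) (Del i (Del j (ent q0)))).
Proof.
move=> t0 ij; set p := expR (- t); have /andP[p0 p1] : 0 < p < 1 := expRN_lt1 t0.
pose K V := ent q0 (V :\ i) + ent q0 (V :\ j) - ent q0 V - ent q0 (V :\ i :\ j).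
have -> : cmi (qt q0 t) i j = Ew p K.
  rewrite /cmi sum_qt sum_q0_Ew -/p; apply: Ew_eq => V.
  rewrite /K /ent -!sumrN -!big_split /=; apply: eq_bigr => z _.
  case: (q0_gt0P q0_ge0 z) => [->|qz]; first by rewrite !mul0r !oppr0 !addr0.
  rewrite qt_reveal !marg_qt_reveal -/p.
  have w0 k : 0 < (if k \in V then p else 1 - p) by case: ifP; rewrite ?subr_gt0.
  set w2 := \prod_(k < d | k \notin [set i; j]%SET) _.
  have w20 : 0 < w2 by exact: prodr_gt0.
  have wtj : \prod_(k < d | k \notin [set j]%SET) (if k \in V then p else 1 - p)
      = (if i \in V then p else 1 - p) * w2.
    rewrite (bigD1 i) ?inE //=; congr (_ * _); apply: eq_bigl => k.
    by rewrite !inE negb_or andbC.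
  have wti : \prod_(k < d | k \notin [set i]%SET) (if k \in V then p else 1 - p)
      = (if j \in V then p else 1 - p) * w2.
    rewrite (bigD1 j) ?inE ?(eq_sym j) //=; congr (_ * _); apply: eq_bigl => k.
    by rewrite !inE negb_or.
  have wtV : wt p V = (if i \in V then p else 1 - p) * (if j \in V then p else 1 - p) * w2.
    rewrite -mulrA -wti (wtE _ i); congr (_ * _); apply: eq_bigl => k.
    by rewrite !inE.
  rewrite wtj wti wtV; have := w0 i; have := w0 j.
  move: (if i \in V then _ else _) (if j \in V then _ else _) => wi wj wj0 wi0.
  have -> : V :\: [set i; j]%SET = V :\ i :\ j.
    by apply/setP => k; rewrite !inE negb_or; case: (k == i); case: (k == j).
  have m0 U : 0 < mar q0 U z := mar_gt0 q0_ge0 U qz.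
  set X := (X in ln X).
  have -> : X = mar q0 V z * mar q0 (V :\ i :\ j) z / (mar q0 (V :\ j) z * mar q0 (V :\ i) z).
    by rewrite /X; field; rewrite !gt_eqF.
  by rewrite ln_div ?posrE ?mulr_gt0 // !lnM ?posrE ?mulr_gt0 //; ring.
(* A masked coordinate carries no information, so only sets containing both [i] and [j] count; this
   produces the factor [p ^+ 2]. *)
have K0 V : (i \notin V) || (j \notin V) -> K V = 0.
  rewrite /K => /orP[iV|jV].
    have -> : V :\ i = V by apply/finset.setDidPl; rewrite disjoint_sym finset.disjoints1.
    by ring.
  have VjE (U : {set 'I_d}) : j \notin U -> U :\ j = U.
    by move=> jU; apply/finset.setDidPl; rewrite disjoint_sym finset.disjoints1.
  rewrite !VjE //; first by ring.
  by rewrite !inE negb_and jV orbT.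
rewrite (Ew_cond p i).
have -> : Ew p (fun V => K (V :\ i)) = 0.
  apply: Ew_eq0 => V; apply: K0; by rewrite !inE eqxx.
rewrite mulr0 addr0 (Ew_cond p j).
have -> : Ew p (fun V => K (i |: V :\ j)) = 0.
  apply: Ew_eq0 => V; apply: K0.
  by rewrite !inE !eqxx /= (eq_sym j) (negbTE ij).
rewrite mulr0 addr0 mulrA -expr2 -mulrN -EwN; congr (_ * _); apply: Ew_eq => V.
rewrite Del2E // /K.
have -> : (i |: (j |: V)) :\ i = j |: (V :\ i :\ j).
  apply/setP => k; rewrite !inE; case: (eqVneq k i) => [->|_]; last by case: (eqVneq k j).
  by rewrite (negbTE ij).
have -> : (i |: (j |: V)) :\ j = i |: (V :\ i :\ j).
  apply/setP => k; rewrite !inE; case: (eqVneq k j) => [->|_]; last by case: (eqVneq k i).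
  by rewrite eq_sym (negbTE ij).
have -> : (j |: (V :\ i :\ j)) :\ j = V :\ i :\ j.
  by apply/setP => k; rewrite !inE; case: (eqVneq k j).
have -> : i |: (j |: (V :\ i :\ j)) = i |: (j |: V).
  by apply/setP => k; rewrite !inE; case: (eqVneq k i); case: (eqVneq k j).
by ring.
Qed.

Lemma Itot_E t : 0 < t ->
  Itot q0 t = - (expR (- t) ^+ 2 * Ew (expR (- t)) (DelT (DelT (ent q0)))).
Proof.
move=> t0; rewrite /Itot (Ew_eq _ (DelT2 _)) Ew_sum mulr_sumr -sumrN.
apply: eq_bigr => i _; rewrite Ew_sum mulr_sumr -sumrN.
by apply: eq_bigr => j ji; rewrite cmi_qt // eq_sym.
Qed.

Lemma setc_reveal z V i b : setc (reveal z V) i (Some b) = reveal (setz z i b) (i |: V).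
Proof.
apply/ffunP => j; rewrite !ffunE finset.in_setU1; by case: eqVneq.
Qed.

(** Revealing [i] multiplies the weight of the visible set by the odds [p / (1 - p)] and the clean
    marginal by [cmar]. *)
Lemma score_reveal t z V i b : 0 < t -> i \notin V ->
  score q0 t (setc (reveal z V) i (Some b)) (reveal z V)
  = expR (- t) / (1 - expR (- t)) * cmar q0 V i z b.
Proof.
move=> t0 iV; rewrite /score setc_reveal !qt_reveal !(wtE _ i) wt'U finset.setU11 (negbTE iV).
rewrite /cmar; set p := expR _; have /andP[p0 p1] : 0 < p < 1 := expRN_lt1 t0.
have w0 : wt' p i V != 0.
  apply/prodf_neq0 => j _; case: ifP => _; first by rewrite gt_eqF.
  by rewrite gt_eqF // subr_gt0.
rewrite !invfM.
have -> : p * wt' p i V * mar q0 (i |: V) (setz z i b) *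
    ((1 - p)^-1 * (wt' p i V)^-1 * (mar q0 V z)^-1)
  = p / (1 - p) * (mar q0 (i |: V) (setz z i b) / mar q0 V z) * (wt' p i V / wt' p i V).
  by ring.
by rewrite divff // mulr1.
Qed.

(** The states that can be masked into [x] in one jump are the fillings of one masked coordinate of
    [x], each obtained from exactly one pair of coordinate and letter. *)
Lemma sum_Qgen x (F : state S d -> R) :
  \sum_(y : state S d | y != x) Qgen R y x * F y
  = \sum_(i in masked x) \sum_b F (setc x i (Some b)).
Proof.
have setcK (y : state S d) i : i \notin masked y -> x = setc y i None ->
    exists b, y i = Some b /\ setc x i (Some b) = y.
  rewrite inE; case yi : (y i) => [b|//] _ ->; exists b; split => //.
  by apply/ffunP => j; rewrite !ffunE; case: eqVneq => [->|]; rewrite ?yi.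
have QE (y : state S d) : (y != x)%:R * Qgen R y x = \sum_(i | (i \notin masked y) && (x == setc y i None)) 1.
  rewrite /Qgen; case: existsP => [[i /andP[iy /eqP xE]]|noi]; last first.
    by rewrite mulr0 big_pred0 // => i; apply/negP => h; apply: noi; exists i.
  rewrite (big_pred1 i).
    suff -> : y != x by rewrite mulr1.
    apply: contraNneq iy => ->; rewrite inE xE ffunE eqxx //.
  move=> j; apply/andP/eqP => [[jy /eqP xE']|->]; last by rewrite iy -xE.
  apply/eqP; apply: contraNT jy => ji; rewrite inE.
  have : x i = None by rewrite xE ffunE eqxx.
  rewrite xE' ffunE; case: eqVneq => // [ij|_]; first by rewrite -ij eqxx in ji.
  by move: iy; rewrite inE => /eqP.
rewrite big_mkcond /=.
transitivity (\sum_(y : state S d) \sum_(i | (i \notin masked y) && (x == setc y i None)) F y).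
  apply: eq_bigr => y _; rewrite -[F y in RHS]mul1r -mulr_suml -QE.
  by case: ifP; rewrite ?mul1r ?mul0r.
rewrite (exchange_big_dep predT) //= [RHS]big_mkcond; apply: eq_bigr => i _.
case: ifP => ix; last first.
  rewrite big_pred0 // => y; apply/negP => /andP[_ /eqP xE].
  by move: ix; rewrite inE xE ffunE !eqxx.
have xiN : x i = None by apply/eqP; move: ix; rewrite inE.
(* The reindexing needs a default letter; with an empty alphabet both sums are empty. *)
have [b0 _|noS] := pickP (@predT 'I_S); last first.
  rewrite [RHS]big_pred0 // big_pred0 // => y; apply/negP => /andP[iy /eqP xE].
  by have [b _] := setcK _ _ iy xE; have := noS b.
rewrite (reindex_onto (fun b => setc x i (Some b)) (fun y : state S d => odflt b0 (y i))) /=; last first.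
  by move=> y /andP[iy /eqP xE]; have [b [-> <-]] := setcK _ _ iy xE.
apply: eq_bigl => b; rewrite inE !ffunE !eqxx /= andbT.
by apply/eqP/ffunP => j; rewrite !ffunE; case: eqVneq => [->|].
Qed.

Lemma L_SE_E t sh : 0 < t -> L_SE q0 t sh = \sum_z q0 z * Ew (expR (- t)) (fun V =>
  \sum_(i < d | i \notin V) \sum_b
     sD (sh (setc (reveal z V) i (Some b)) (reveal z V))
        (expR (- t) / (1 - expR (- t)) * cmar q0 V i z b)).
Proof.
move=> t0; rewrite /L_SE sum_qt; apply: eq_bigr => z _; congr (_ * _); apply: Ew_eq => V.
rewrite sum_Qgen; apply: eq_big => [i|i]; rewrite masked_reveal // => iV.
by apply: eq_bigr => b _; rewrite score_reveal.
Qed.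

End MaskedLaw.

(** * Relative entropy on finite sets *)

Section FiniteKL.
Variables (R : realType) (X : finType).
Implicit Types (q p : X -> R).

Lemma ln_prod (P : pred X) q : (forall x, P x -> 0 < q x) ->
  ln (\prod_(x | P x) q x) = \sum_(x | P x) ln (q x).
Proof.
move=> q0.
suff [] : ln (\prod_(x | P x) q x) = \sum_(x | P x) ln (q x) /\ 0 < \prod_(x | P x) q x by [].
apply: (big_ind2 (fun a b => ln a = b /\ 0 < a)) => [|a b a' b' [<- ?] [<- ?]|x Px].
- by rewrite ln1 ltr01.
- by rewrite lnM ?posrE // mulr_gt0.
- by split => //; exact: q0.
Qed.

(** Rescaling [b] by [A / B] gives both families the same total, so the corrections from
    [mul_ln_div_le] sum to zero. *)
Lemma log_sum (I : finType) (a b : I -> R) : (forall i, 0 <= a i) -> (forall i, 0 <= b i) ->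
  (forall i, 0 < a i -> 0 < b i) ->
  (\sum_i a i) * ln ((\sum_i a i) / \sum_i b i) <= \sum_i a i * ln (a i / b i).
Proof.
move=> a0 b0 ab; set A := \sum_i a i; set B := \sum_i b i.
have : 0 <= A by exact: sumr_ge0.
rewrite le_eqVlt => /predU1P[AE|A0].
  have az i : a i = 0 by apply: (psumr_eq0P _ (esym AE)).
  by rewrite -AE mul0r big1 // => i _; rewrite az mul0r.
have B0 : 0 < B.
  have [i /andP[_ ai]] : exists i, true && (0 < a i).
    by apply/(psumr_neq0P (P := predT)) => //; apply/eqP; rewrite -/A gt_eqF.
  by rewrite /B (bigD1 i) //= ltr_wpDr ?ab // sumr_ge0.
have step i : a i * ln (A / B) - (b i * (A / B) - a i) <= a i * ln (a i / b i).
  have AB : 0 < A / B by rewrite divr_gt0.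
  have := @mul_ln_div_le R (a i) (b i * (A / B)) (a0 i) (mulr_ge0 (b0 i) (ltW AB)).
  have := a0 i; rewrite le_eqVlt => /predU1P[<- _|ai].
    by rewrite !mul0r sub0r subr0 oppr_le0 mulr_ge0 // ltW.
  have bi := ab _ ai.
  move=> /(_ (fun=> mulr_gt0 bi AB)).
  have -> : ln (b i * (A / B) / a i) = ln (A / B) - ln (a i / b i).
    by rewrite !lnM ?posrE ?mulr_gt0 ?invr_gt0 // !lnV ?posrE //; ring.
  by rewrite mulrBr; lra.
apply: le_trans (_ : \sum_i (a i * ln (A / B) - (b i * (A / B) - a i)) <= _).
  rewrite sumrB -mulr_suml -/A sumrB -mulr_suml -/B -/A.
  by rewrite (mulrC B) divfK ?gt_eqF // subrr subr0.
exact: ler_sum.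
Qed.

Definition KLr q p : R := \sum_x q x * ln (q x / p x).

(** Forgetting the starting point [x] cannot increase the divergence, by [log_sum]; the logarithm of
    the joint ratio then splits into an initial and a transition part. *)
Lemma KLr_chain (J K : X -> X -> R) q p :
  (forall x y, 0 <= J x y) -> (forall x y, 0 <= K x y) ->
  (forall x y, 0 < J x y -> 0 < K x y) -> (forall x, 0 < p x) ->
  (forall x, q x = \sum_y J x y) ->
  KLr (fun y => \sum_x J x y) (fun y => \sum_x p x * K x y)
  <= KLr q p + \sum_x \sum_y J x y * ln (J x y / (q x * K x y)).
Proof.
move=> J0 K0 JK p0 qE.
apply: le_trans (_ : \sum_y \sum_x J x y * ln (J x y / (p x * K x y)) <= _).
  apply: ler_sum => y _; apply: log_sum => x //; first by rewrite mulr_ge0 // ltW.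
  by move=> /JK Kx; rewrite mulr_gt0.
rewrite exchange_big /KLr -big_split /=; apply: ler_sum => x _.
rewrite {1}qE mulr_suml -big_split; apply: ler_sum => y _ /=.
have := J0 x y; rewrite le_eqVlt => /predU1P[<-|Jxy]; first by rewrite !mul0r addr0.
have qx : 0 < q x by rewrite qE (bigD1 y) //= ltr_wpDr // sumr_ge0.
have Kxy := JK _ _ Jxy.
rewrite -mulrDr -lnM ?posrE ?divr_gt0 ?mulr_gt0 //.
suff -> : J x y / (p x * K x y) = q x / p x * (J x y / (q x * K x y)) by [].
by field; rewrite !gt_eqF.
Qed.

End FiniteKL.

(** * One reverse step: the true transition against the leaping kernel *)

Section ReverseStep.
Variables (R : realType) (S d : nat) (q0 : clean S d -> R).
Hypothesis q0_ge0 : forall z, 0 <= q0 z.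
Hypothesis q0_sum : \sum_z q0 z = 1.
Variables (sigma h : R).
Hypotheses (sigma_gt0 : 0 < sigma) (h_gt0 : 0 < h).
Implicit Types (V W U : {set 'I_d}) (z : clean S d) (i j : 'I_d) (b : 'I_S)
  (x y : state S d).

(** Reverse time runs from [tau] to [sigma], with visibility rising from [p0] to [p1]; this [p0]
    hides the initial law of the same name. The odds [a] are the total true rate of unmasking a
    masked coordinate at [tau], and [r] is the probability that such a coordinate is visible at
    [sigma]. *)
Let tau := sigma + h.
Let p0 := expR (- tau).
Let p1 := expR (- sigma).
Let a := p0 / (1 - p0).
Let m := expR h - 1.
Let r := a * m.

Let tau_gt0 : 0 < tau. Proof. exact: addr_gt0. Qed.

Let p0_itv : 0 < p0 < 1. Proof. exact: expRN_lt1. Qed.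

Let p0_itv' : 0 <= p0 <= 1.
Proof. by have /andP[/ltW -> /ltW ->] := p0_itv. Qed.

Let p1E : p1 = p0 * expR h.
Proof. by rewrite /p1 /p0 -expRD; congr expR; rewrite /tau; ring. Qed.

Let a_gt0 : 0 < a.
Proof. by have /andP[? ?] := p0_itv; rewrite divr_gt0 // subr_gt0. Qed.

Let m_gt0 : 0 < m. Proof. by rewrite subr_gt0 expR_gt1. Qed.

Let r_gt0 : 0 < r. Proof. exact: mulr_gt0. Qed.

Let rE : p0 + (1 - p0) * r = p1.
Proof.
rewrite /r /a p1E /m; field.
by have /andP[_ ?] := p0_itv; rewrite gt_eqF // subr_gt0.
Qed.

Let r_lt1 : r < 1.
Proof.
have /andP[_ p01] := p0_itv; have /andP[_ p11] := expRN_lt1 sigma_gt0.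
have : (1 - p0) * r < (1 - p0) * 1 
  by rewrite mulr1; have := rE; rewrite /p1; move: p11; lra.
by rewrite ltr_pM2l // subr_gt0.
Qed.

(** Transition probability of the visible set from [tau] to [sigma]; it vanishes unless [V] is
    contained in [U]. *)
Definition rho V U : R :=
  \prod_(i < d) (if i \in V then (i \in U)%:R else if i \in U then r else 1 - r).

Lemma rho_ge0 V U : 0 <= rho V U.
Proof.
apply: prodr_ge0 => i _; case: ifP => _; first by rewrite ler0n.
by case: ifP => _; rewrite ?subr_ge0 ltW.
Qed.

Lemma rho_gt0_sub V U : 0 < rho V U -> V \subset U.
Proof.
move=> rh; apply/fintype.subsetP => i iV; apply: contraLR rh => iU.
by rewrite /rho (bigD1 i) //= iV (negbTE iU) mul0r ltxx.
Qed.

Lemma sum_rho V : \sum_U rho V U = 1.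
Proof.
transitivity (\prod_(i < d) ((if i \in V then 1 else r) + (if i \in V then 0 else 1 - r))).
  rewrite bigA_distr; apply: eq_bigr => U _; apply: eq_bigr => i _.
  by case: (i \in V); case: (i \in U).
by apply: big1 => i _; case: ifP => _; rewrite ?addr0 // addrC subrK.
Qed.

Lemma sum_rho_coord V i (A B : R) : i \notin V ->
  \sum_U rho V U * (if i \in U then A else B) = r * A + (1 - r) * B.
Proof.
move=> iV.
transitivity (\prod_(j < d)
   ((if j == i then r * A else if j \in V then 1 else r)
    + (if j == i then (1 - r) * B else if j \in V then 0 else 1 - r))).
  rewrite bigA_distr; apply: eq_bigr => U _; rewrite /rho !(bigD1 i (P := predT)) //=.
  rewrite eqxx (negbTE iV) mulrAC; congr (_ * _); first by case: ifP.
  apply: eq_bigr => j /negbTE ->; by case: (j \in V); case: (j \in U).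
rewrite (bigD1 i) //= eqxx big1 ?mulr1 // => j /negbTE ->.
by case: ifP => _; rewrite ?addr0 // addrC subrK.
Qed.

Lemma sum_wt_rho U : \sum_V wt p0 V * rho V U = wt p1 U.
Proof.
transitivity (\prod_(i < d) (p0 * (i \in U)%:R + (1 - p0) * (if i \in U then r else 1 - r))).
  rewrite bigA_distr; apply: eq_bigr => V _; rewrite /wt /rho -big_split /=.
  by apply: eq_bigr => i _; case: ifP.
apply: eq_bigr => i _; case: ifP => _; first by rewrite mulr1 rE.
by rewrite -rE /=; ring.
Qed.

Lemma Ew_sum_rho (g : {set 'I_d} -> R) :
  Ew p0 (fun V => \sum_U rho V U * g U) = Ew p1 g.
Proof.
rewrite /Ew; under eq_bigr do rewrite mulr_sumr.
rewrite exchange_big; apply: eq_bigr => U _; rewrite -sum_wt_rho mulr_suml.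
by apply: eq_bigr => V _; rewrite mulrA.
Qed.

(* The joint law of the forward process at the times tau and sigma, sampled by
   first revealing V at time tau and then U, a superset of V, at time sigma. *)
Definition joint x y : R := \sum_z q0 z * Ew p0 (fun V =>
  \sum_U rho V U * ((x == reveal z V)%:R * (y == reveal z U)%:R)).

Lemma joint_ge0 x y : 0 <= joint x y.
Proof.
apply: sumr_ge0 => z _; rewrite mulr_ge0 // Ew_ge0 // => V.
by apply: sumr_ge0 => U _; rewrite !mulr_ge0 ?rho_ge0 ?ler0n.
Qed.

Lemma sum_joint (g : state S d -> state S d -> R) :
  \sum_x \sum_y joint x y * g x y = \sum_z q0 z * Ew p0 (fun V =>
     \sum_U rho V U * g (reveal z V) (reveal z U)).
Proof.
pose ind z V U x y : R := (x == reveal z V)%:R * (y == reveal z U)%:R.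
transitivity (\sum_x \sum_y \sum_z \sum_V \sum_U
   q0 z * (wt p0 V * (rho V U * (ind z V U x y * g x y)))).
  apply: eq_bigr => x _; apply: eq_bigr => y _; rewrite /joint mulr_suml.
  apply: eq_bigr => z _; rewrite /Ew mulr_sumr mulr_suml; apply: eq_bigr => V _.
  rewrite !mulr_sumr mulr_suml; apply: eq_bigr => U _; rewrite /ind; ring.
under eq_bigr do rewrite exchange_big; rewrite exchange_big; apply: eq_bigr => z _.
rewrite /Ew mulr_sumr.
under eq_bigr do rewrite exchange_big; rewrite exchange_big; apply: eq_bigr => V _.
rewrite !mulr_sumr.
under eq_bigr do rewrite exchange_big; rewrite exchange_big; apply: eq_bigr => U _.
rewrite (bigD1 (reveal z V)) //= [X in _ + X]big1 ?addr0; last first.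
  by move=> x /negbTE xV; apply: big1 => y _; rewrite /ind xV !(mul0r, mulr0).
rewrite (bigD1 (reveal z U)) //= [X in _ + X]big1 ?addr0; last first.
  by move=> y /negbTE yU; rewrite /ind yU !(mul0r, mulr0).
by rewrite /ind !eqxx !mul1r.
Qed.

Lemma sum_joint_r x : \sum_y joint x y = qt q0 tau x.
Proof.
have := sum_joint (fun x' _ => (x' == x)%:R).
rewrite (bigD1 x) //= [X in _ + X]big1 ?addr0; last first.
  by move=> x' /negbTE xx; apply: big1 => y _; rewrite xx mulr0.
under eq_bigr do rewrite eqxx mulr1; move=> ->.
have := sum_qt q0 tau (fun x' => (x' == x)%:R).
rewrite (bigD1 x) //= eqxx mulr1 [X in _ + X]big1 ?addr0; last first.
  by move=> x' /negbTE xx; rewrite xx mulr0.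
move=> ->; apply: eq_bigr => z _; congr (_ * _); apply: Ew_eq => V.
by rewrite -mulr_suml sum_rho mul1r.
Qed.

Lemma sum_joint_l y : \sum_x joint x y = qt q0 sigma y.
Proof.
have := sum_joint (fun _ y' => (y' == y)%:R).
rewrite exchange_big (bigD1 y) //= [X in _ + X]big1 ?addr0; last first.
  by move=> y' /negbTE yy; apply: big1 => x _; rewrite yy mulr0.
under eq_bigr do rewrite eqxx mulr1; move=> ->.
have := sum_qt q0 sigma (fun y' => (y' == y)%:R).
rewrite (bigD1 y) //= eqxx mulr1 [X in _ + X]big1 ?addr0; last first.
  by move=> y' /negbTE yy; rewrite yy mulr0.
by move=> ->; apply: eq_bigr => z _; rewrite Ew_sum_rho.
Qed.

Lemma joint_reveal z V U : joint (reveal z V) (reveal z U) = wt p0 V * rho V U * mar q0 U z.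
Proof.
have [VU|VU] := boolP (V \subset U); last first.
  have r0 : rho V U = 0.
    by apply/eqP; rewrite eq_le rho_ge0 andbT leNgt; apply: contraNN VU => /rho_gt0_sub.
  rewrite r0 mulr0 mul0r; apply: big1 => y _; rewrite Ew_eq0 ?mulr0 // => V'.
  apply: big1 => U' _; rewrite !reveal_eqE.
  case: eqVneq => [<-|_]; last by rewrite !(mul0r, mulr0).
  case: eqVneq => [<-|_]; last by rewrite !(mul0r, mulr0).
  by rewrite r0 !(mul0r, mulr0).
rewrite /joint /mar mulr_sumr [RHS]big_mkcond; apply: eq_bigr => y _.
rewrite /Ew (bigD1 V) //= [X in _ + X]big1 ?addr0; last first.
  move=> V' V'V; rewrite big1 ?mulr0 // => U' _.
  by rewrite reveal_eqE eq_sym (negbTE V'V) !(mul0r, mulr0).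
rewrite (bigD1 U) //= [X in _ + X]big1 ?addr0; last first.
  by move=> U' U'U; rewrite !reveal_eqE (eq_sym U) (negbTE U'U) !mulr0.
rewrite !reveal_eqE !eqxx /=.
case: ifP => zy; last by rewrite !mulr0.
by rewrite (agree_sub VU zy) !mulr1; ring.
Qed.

Variable sh : state S d -> state S d -> R.
Hypothesis sh_gt0 : forall y x, 0 < sh y x.

Lemma Lam_gt0 x i b : 0 < Lam sh x i.
Proof.
by rewrite /Lam (bigD1 b) //= ltr_wpDr // sumr_ge0 // => c _; exact: ltW.
Qed.

Lemma step1_ge0 x i c : 0 <= step1 h sh x i c.
Proof.
rewrite /step1; case: (x i) => [b|]; first by case: ifP.
case: c => [b|]; last exact: expR_ge0.
have L0 := Lam_gt0 x i b.
rewrite mulr_ge0 ?divr_ge0 ?ltW // subr_gt0 expR_lt1 oppr_lt0.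
exact: mulr_gt0.
Qed.

Lemma kernel_ge0 x y : 0 <= Defs.kernel h sh x y.
Proof. by apply: prodr_ge0 => i _; exact: step1_ge0. Qed.

Let unmask_prob z V i := (1 - expR (- (h * Lam sh (reveal z V) i))) *
   (sh (setc (reveal z V) i (Some (z i))) (reveal z V) / Lam sh (reveal z V) i).

Let unmask_prob_gt0 z V i : 0 < unmask_prob z V i.
Proof.
have L0 := Lam_gt0 (reveal z V) i (z i).
rewrite /unmask_prob mulr_gt0 ?divr_gt0 // subr_gt0 expR_lt1 oppr_lt0.
exact: mulr_gt0.
Qed.

Lemma kernel_reveal z V U : V \subset U -> Defs.kernel h sh (reveal z V) (reveal z U) =
  \prod_(i < d | i \notin V)
    (if i \in U then unmask_prob z V i else expR (- (h * Lam sh (reveal z V) i))).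
Proof.
move=> /fintype.subsetP VU; rewrite [RHS]big_mkcond; apply: eq_bigr => i _.
rewrite /step1 !ffunE; case: ifPn => iV /=; last by case: ifP.
by rewrite (VU _ iV) eqxx.
Qed.

Lemma kernel_reveal_gt0 z V U : V \subset U -> 0 < Defs.kernel h sh (reveal z V) (reveal z U).
Proof.
move=> VU; rewrite kernel_reveal //; apply: prodr_gt0 => i _.
by case: ifP; rewrite ?expR_gt0.
Qed.

Lemma kernel_gt0_joint x y : 0 < joint x y -> 0 < Defs.kernel h sh x y.
Proof.
apply: contraTT => /negP K0; rewrite -leNgt /joint big1 // => z _.
rewrite Ew_eq0 ?mulr0 // => V; apply: big1 => U _.
case: eqVneq => [xV|_]; last by rewrite !(mul0r, mulr0).
case: eqVneq => [yU|_]; last by rewrite !(mul0r, mulr0).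
have := rho_ge0 V U; rewrite le_eqVlt => /predU1P[<-|/rho_gt0_sub VU].
  by rewrite mul0r.
by case: K0; rewrite xV yU kernel_reveal_gt0.
Qed.

Let logstep z V U i := if i \in U then ln r - ln (unmask_prob z V i)
  else ln (1 - r) + h * Lam sh (reveal z V) i.

(** The weight of [V] cancels. The rest splits into a clean-word part, which averages to entropies,
    and a sum over the masked coordinates. *)
Lemma ln_joint_ratio z V U : 0 < q0 z -> 0 < rho V U ->
  ln (joint (reveal z V) (reveal z U) /
      (qt q0 tau (reveal z V) * Defs.kernel h sh (reveal z V) (reveal z U)))
  = ln (mar q0 U z) - ln (mar q0 V z) + \sum_(i < d | i \notin V) logstep z V U i.
Proof.
move=> qz rh; have VU := rho_gt0_sub rh.
have mU := mar_gt0 q0_ge0 U qz; have mV := mar_gt0 q0_ge0 V qz.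
have wV : 0 < wt p0 V by apply: wt_gt0; exact: p0_itv.
have kVU := kernel_reveal_gt0 z VU.
rewrite joint_reveal qt_reveal -/p0.
set K := Defs.kernel _ _ _ _ in kVU *.
have -> : wt p0 V * rho V U * mar q0 U z / (wt p0 V * mar q0 V z * K)
  = (mar q0 U z / mar q0 V z) * (rho V U / K) by field; rewrite !gt_eqF.
rewrite lnM ?posrE ?divr_gt0 // ln_div ?posrE //; congr (_ + _).
have -> : rho V U = \prod_(i < d | i \notin V) (if i \in U then r else 1 - r).
  rewrite /rho [RHS]big_mkcond; apply: eq_bigr => i _.
  by case: ifPn => //= /(fintype.subsetP VU) ->.
have r1 : 0 < 1 - r by rewrite subr_gt0.
rewrite /K kernel_reveal // -prodf_div ln_prod => [|i _]; last first.
  by case: ifP => _; rewrite divr_gt0 // ?expR_gt0.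
apply: eq_bigr => i _; rewrite /logstep; case: ifP => _.
  by rewrite ln_div ?posrE.
by rewrite ln_div ?posrE ?expR_gt0 // expRK opprK.
Qed.

Definition path_cost : R := \sum_x \sum_y joint x y *
  ln (joint x y / (qt q0 tau x * Defs.kernel h sh x y)).

(** The mean of [logstep] over [U], which contains a masked [i] with probability [r]. *)
Let marginal_cost z V i := r * (ln r - ln (unmask_prob z V i))
  + (1 - r) * (ln (1 - r) + h * Lam sh (reveal z V) i).

Lemma path_costE : path_cost = Ew p0 (ent q0) - Ew p1 (ent q0)
  + Ew p0 (fun V => \sum_(i < d | i \notin V) \sum_z q0 z * marginal_cost z V i).
Proof.
have -> : Ew p0 (fun V => \sum_(i < d | i \notin V) \sum_z q0 z * marginal_cost z V i)
  = \sum_z q0 z * Ew p0 (fun V => \sum_(i < d | i \notin V) marginal_cost z V i).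
  rewrite sum_q0_Ew; apply: Ew_eq => V; rewrite exchange_big; apply: eq_bigr => z _.
  by rewrite mulr_sumr.
have entE p : Ew p (ent q0) = - \sum_z q0 z * Ew p (fun V => ln (mar q0 V z)).
  by rewrite sum_q0_Ew -EwN.
rewrite /path_cost (sum_joint (fun x y => ln (joint x y / (qt q0 tau x * Defs.kernel h sh x y)))).
rewrite !entE opprK (addrC (- _)) -sumrB -big_split; apply: eq_bigr => z _ /=.
case: (q0_gt0P q0_ge0 z) => [->|qz]; first by rewrite !mul0r subrr addr0.
rewrite -mulrBr -mulrDr; congr (_ * _).
rewrite -Ew_sum_rho -EwB -EwD; apply: Ew_eq => V.
transitivity (\sum_U rho V U * (ln (mar q0 U z) - ln (mar q0 V z)
   + \sum_(i < d | i \notin V) logstep z V U i)).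
  apply: eq_bigr => U _; have := rho_ge0 V U.
  by rewrite le_eqVlt => /predU1P[<-|rh]; rewrite ?mul0r // ln_joint_ratio.
under [LHS]eq_bigr do rewrite mulrDr mulrBr mulr_sumr.
rewrite big_split sumrB -mulr_suml sum_rho mul1r /=; congr (_ + _).
rewrite exchange_big; apply: eq_bigr => i iV; exact: sum_rho_coord.
Qed.

Variables (kappa G : R).
Hypotheses (h_le : h <= kappa) (ah_le : a * h <= kappa) (eh_le : expR h <= G).

Let sc z V i b := a * cmar q0 V i z b.
Let shb z V i b := sh (setc (reveal z V) i (Some b)) (reveal z V).

Let step_bound z V i := h * (\sum_b sD (shb z V i b) (sc z V i b))
  + 2 * G ^+ 3 * (kappa * (h * \sum_b sc z V i b * `|ln (shb z V i b / sc z V i b)|)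
                  + kappa ^+ 3).

(** Splitting off [r] times the entropy of the letter at [i] given [V] leaves a one-coordinate KL
    divergence, to which [marginal_step_le] applies. *)
Lemma marginal_cost_le V i : i \notin V ->
  \sum_z q0 z * marginal_cost z V i
  <= r * (ent q0 (i |: V) - ent q0 V) + \sum_z q0 z * step_bound z V i.
Proof.
move=> iV; pose F z b := ln (shb z V i b / sc z V i b).
pose L z := Lam sh (reveal z V) i.
pose Y z := r * ln (m * L z / (1 - expR (- (h * L z)))) + (1 - r) * (ln (1 - r) + h * L z).
have FV z (y : clean S d) b : agree V z y -> F z b = F y b.
  move=> zy; rewrite /F /shb /sc (cmar_agree _ _ _ zy).
  by have /eqP -> : reveal z V == reveal y V by rewrite reveal_eqE eqxx.
have -> : \sum_z q0 z * marginal_cost z V i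
  = r * (ent q0 (i |: V) - ent q0 V) + \sum_z q0 z * Y z - r * \sum_z q0 z * F z (z i).
  rewrite /ent opprK (addrC (- _)) -sumrB !mulr_sumr -big_split -sumrB.
  apply: eq_bigr => z _ /=.
  case: (q0_gt0P q0_ge0 z) => [->|qz]; first by rewrite !(mul0r, subr0, mulr0, addr0).
  have mU := mar_gt0 q0_ge0 (i |: V) qz; have mV := mar_gt0 q0_ge0 V qz.
  have L0 : 0 < L z := Lam_gt0 (reveal z V) i (z i).
  have e0 : 0 < 1 - expR (- (h * L z)).
    by rewrite subr_gt0 expR_lt1 oppr_lt0 mulr_gt0.
  have s0 : 0 < shb z V i (z i) := sh_gt0 _ _.
  have C0 : 0 < mar q0 (i |: V) z / mar q0 V z by rewrite divr_gt0.
  have lnr : ln r = ln a + ln m by rewrite -lnM ?posrE.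
  have lnu : ln (unmask_prob z V i)
      = ln (1 - expR (- (h * L z))) + (ln (shb z V i (z i)) - ln (L z)).
    by rewrite -ln_div ?posrE // -lnM ?posrE ?divr_gt0.
  have lnY : ln (m * L z / (1 - expR (- (h * L z))))
      = ln m + ln (L z) - ln (1 - expR (- (h * L z))).
    by rewrite ln_div ?posrE ?mulr_gt0 // lnM ?posrE.
  have lnF : F z (z i) = ln (shb z V i (z i))
      - (ln a + (ln (mar q0 (i |: V) z) - ln (mar q0 V z))).
    rewrite /F /sc /cmar setz_id [LHS]ln_div ?posrE ?(mulr_gt0 a_gt0 C0) //.
    by congr (_ - _); rewrite [LHS]lnM ?posrE // [X in _ + X = _]ln_div ?posrE.
  rewrite /marginal_cost /Y lnr lnu lnY lnF -/(L z); ring.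
(* The revealed letter is replaced by its conditional law, which is the family of true rates [sc]
   divided by [a]. *)
rewrite (cmar_conv q0_ge0 iV FV) -addrA lerD2l mulr_sumr -sumrB.
apply: ler_sum => z _.
case: (q0_gt0P q0_ge0 z) => [->|qz]; first by rewrite !mul0r mulr0 subr0.
rewrite mulrCA -mulrBr ler_pM2l //.
have := @marginal_step_le R 'I_S (shb z V i) (sc z V i) a h kappa G h_gt0 h_le a_gt0 ah_le eh_le r_lt1.
move=> H; apply: le_trans (H _ _ _) => {H}.
- rewrite -/m -/r -[\sum_b shb _ _ _ _]/(L z) /Y.
  have -> : r * \sum_b cmar q0 V i z b * F z b
      = m * \sum_b sc z V i b * ln (shb z V i b / sc z V i b).
    by rewrite !mulr_sumr; apply: eq_bigr => b _; rewrite /r /sc /F; ring.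
  by lra.
- by move=> b; rewrite mulr_ge0 ?cmar_ge0 // ltW.
- by rewrite -mulr_sumr sum_cmar1 ?mulr1 // mar_gt0.
- by move=> b; exact: sh_gt0.
Qed.

(** Only sets without [i] contribute; they have probability [1 - p], and on them the increment is
    [Del i f]. *)
Lemma Ew_increment (f : {set 'I_d} -> R) p :
  Ew p (fun V => \sum_(i < d | i \notin V) (f (i |: V) - f V)) = (1 - p) * Ew p (DelT f).
Proof.
rewrite Ew_DelT mulr_sumr; under Ew_eq do rewrite big_mkcond; rewrite Ew_sum.
apply: eq_bigr => i _; rewrite (Ew_cond p i) [X in p * X]Ew_eq0; last first.
  by move=> V; rewrite finset.setU11.
rewrite mulr0 add0r; congr (_ * _); apply: Ew_eq => V; rewrite finset.setD11 /= /Del.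
by congr (f _ - _); apply/setP => j; rewrite !inE; case: (eqVneq j i).
Qed.

Definition abs_log_error : R := \sum_(x : state S d) qt q0 tau x *
  \sum_(i in masked x) \sum_(c : 'I_S) score q0 tau (setc x i (Some c)) x *
    `| ln (sh (setc x i (Some c)) x / score q0 tau (setc x i (Some c)) x) |.

(** By [Ew_increment] the single-letter entropies add up to [p1 - p0] times the derivative of the
    mean entropy. With the entropy difference of [path_costE] they form the total correlation of the
    letters revealed in the step. *)
Lemma path_cost_le : path_cost <=
  (Ew p0 (ent q0) - Ew p1 (ent q0) + (p1 - p0) * Ew p0 (DelT (ent q0)))
  + h * L_SE q0 tau sh
  + 2 * G ^+ 3 * (kappa * (h * abs_log_error) + kappa ^+ 3 * d%:R).
Proof.
rewrite path_costE -!addrA lerD2l lerD2l.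
have p01 : p1 - p0 = r * (1 - p0) by rewrite -rE; ring.
have k0 : 0 <= kappa by apply: le_trans h_le; exact: ltW.
have G0 : 0 <= G by apply: le_trans eh_le; exact: expR_ge0.
rewrite p01 -mulrA -Ew_increment -EwZ.
have -> : L_SE q0 tau sh = Ew p0 (fun V => \sum_(i < d | i \notin V)
    \sum_z q0 z * \sum_b sD (shb z V i b) (sc z V i b)).
  rewrite L_SE_E // sum_q0_Ew; apply: Ew_eq => V; rewrite exchange_big; apply: eq_bigr => z _.
  by rewrite mulr_sumr.
have -> : abs_log_error = Ew p0 (fun V => \sum_(i < d | i \notin V)
    \sum_z q0 z * \sum_b sc z V i b * `|ln (shb z V i b / sc z V i b)|).
  rewrite /abs_log_error sum_qt sum_q0_Ew; apply: Ew_eq => V; rewrite exchange_big.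
  apply: eq_bigr => z _; rewrite -mulr_sumr; congr (_ * _).
  apply: eq_big => [i|i]; rewrite masked_reveal // => iV.
  by apply: eq_bigr => b _; rewrite score_reveal.
set E1 := Ew _ (fun V => \sum_(i < d | _) \sum_z _ * \sum_b sD _ _).
set E2 := Ew _ (fun V => \sum_(i < d | _) \sum_z _ * \sum_b _ * `|_|).
have -> : h * E1 + 2 * G ^+ 3 * (kappa * (h * E2) + kappa ^+ 3 * d%:R)
  = Ew p0 (fun V => h * \sum_(i < d | i \notin V)
      \sum_z q0 z * (\sum_b sD (shb z V i b) (sc z V i b))
    + 2 * G ^+ 3 * (kappa * (h * \sum_(i < d | i \notin V)
      \sum_z q0 z * (\sum_b sc z V i b * `|ln (shb z V i b / sc z V i b)|))
      + kappa ^+ 3 * d%:R)).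
  by rewrite EwD EwZ EwZ EwD EwZ EwZ Ew_cst.
rewrite -EwD; apply: le_Ew => // V.
apply: le_trans (_ : _ <= \sum_(i < d | i \notin V) (r * (ent q0 (i |: V) - ent q0 V)
   + \sum_z q0 z * step_bound z V i)) _.
  by apply: ler_sum => i; exact: marginal_cost_le.
rewrite big_split mulr_sumr lerD2l /=.
have -> : \sum_(i < d | i \notin V) \sum_z q0 z * step_bound z V i
  = h * (\sum_(i < d | i \notin V) \sum_z q0 z * \sum_b sD (shb z V i b) (sc z V i b))
  + 2 * G ^+ 3 * (kappa * (h * \sum_(i < d | i \notin V)
      \sum_z q0 z * \sum_b sc z V i b * `|ln (shb z V i b / sc z V i b)|)
      + kappa ^+ 3 * \sum_(i < d | i \notin V) 1).
  rewrite !mulr_sumr -!big_split mulr_sumr -big_split; apply: eq_bigr => i iV /=.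
  have -> : kappa ^+ 3 * 1 = kappa ^+ 3 * \sum_z q0 z by rewrite q0_sum.
  rewrite !mulr_sumr -!big_split mulr_sumr -big_split.
  apply: eq_bigr => z _; rewrite /step_bound /=; ring.
rewrite lerD2l ler_wpM2l ?mulr_ge0 ?exprn_ge0 // lerD2l ler_wpM2l ?exprn_ge0 //.
(* The cubic error is paid once per masked coordinate, hence at most [d] times. *)
by rewrite sumr_const ler_nat -[leqRHS]card_ord max_card.
Qed.

End ReverseStep.

(** * The initialization error *)

Section InitialLaw.
Variables (R : realType) (S d : nat) (q0 : clean S d -> R).
Hypothesis q0_ge0 : forall z, 0 <= q0 z.
Hypothesis q0_sum : \sum_z q0 z = 1.

(** Both laws give the mask pattern the same weight, and visible letters are uniform under [p0]. So
    the log ratio is at most [ln S%:R] per visible coordinate, of which there are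
    [expR (- T) * d%:R] on average. *)
Lemma KLr_initial_le (T : R) : 0 < T ->
  KLr (qt q0 T) (@p0 R S d T) <= expR (- T) * d%:R * ln S%:R.
Proof.
move=> T0; have p_itv := expRN_lt1 T0; have /andP[pos_p lt1_p] := p_itv.
rewrite /KLr sum_qt; set p := expR (- T) in p_itv pos_p lt1_p *.
have EwE : Ew p (fun V : {set 'I_d} => \sum_(i in V) ln S%:R) = p * d%:R * ln S%:R.
  under Ew_eq do rewrite big_mkcond; rewrite Ew_sum.
  rewrite (eq_bigr (fun=> p * ln S%:R)).
    by rewrite sumr_const card_ord -[LHS]mulr_natr; ring.
  move=> i _; rewrite (Ew_cond p i) [X in _ + (1 - p) * X]Ew_eq0; last first.
    by move=> V; rewrite finset.setD11.
  by rewrite mulr0 addr0; under Ew_eq do rewrite finset.setU11; rewrite Ew_cst.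
rewrite -EwE; set E := Ew p _.
have -> : E = \sum_z q0 z * E by rewrite -mulr_suml q0_sum mul1r.
apply: ler_sum => z _.
case: (q0_gt0P q0_ge0 z) => [->|qz]; first by rewrite !mul0r.
rewrite ler_pM2l //; apply: le_Ew => [|V]; first by rewrite !ltW.
have S0 i : i \in V -> 0 < S%:R :> R.
  by move=> _; rewrite ltr0n; apply: leq_ltn_trans (ltn_ord (z i)).
have -> : p0 T (reveal z V) = wt p V * (\prod_(i in V) S%:R)^-1.
  rewrite -prodfV /p0 /wt [\prod_(i in V) _]big_mkcond -big_split; apply: eq_bigr => i _ /=.
  by rewrite ffunE; case: ifP; rewrite ?mulr1.
have P0 : 0 < \prod_(i in V) (S%:R : R) by apply: prodr_gt0.
have w0 := wt_gt0 V p_itv; have m0 := mar_gt0 q0_ge0 V qz.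
rewrite qt_reveal -/p.
have -> : wt p V * mar q0 V z / (wt p V * (\prod_(i in V) S%:R)^-1)
    = mar q0 V z * \prod_(i in V) S%:R by field; rewrite !gt_eqF.
rewrite lnM ?posrE // ln_prod // gerDr.
by apply: ln_le0; exact: mar_le1.
Qed.

End InitialLaw.

(** * Total correlation of a step and the integral of the mutual information *)

Section TotalCorrelation.
Variables (R : realType) (S d : nat) (q0 : clean S d -> R).
Hypothesis q0_ge0 : forall z, 0 <= q0 z.
Hypothesis q0_sum : \sum_z q0 z = 1.
Implicit Types (t : R) (a : {set 'I_d} -> R).

Local Notation H := (ent q0).
Local Notation H' := (DelT (ent q0)).
Local Notation H'' := (DelT (DelT (ent q0))).

Lemma is_derive_Ew_expRN t a : is_derive t (1 : R) (fun s => Ew (expR (- s)) a)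
  (- (expR (- t) * Ew (expR (- t)) (DelT a))).
Proof.
have hg : is_derive t (1 : R) (fun s : R => expR (- s)) (- expR (- t)).
  by apply: is_derive_eq; rewrite /GRing.scale /=; ring.
have hf := is_derive_Ew (expR (- t)) a.
have hc := @is_derive1_comp R (fun x => Ew x a) (fun s => expR (- s)) t _ _ hf hg.
by apply: (is_derive_eq hc); ring.
Qed.

Lemma Itot_ge0 t : 0 < t -> 0 <= Itot q0 t.
Proof.
move=> t0; rewrite Itot_E // oppr_ge0 mulr_ge0_le0 ?sqr_ge0 //.
rewrite -oppr_ge0 -EwN Ew_ge0 // => [|V].
  by have /andP[/ltW -> /ltW ->] := expRN_lt1 t0.
by rewrite oppr_ge0 DelT2_ent_le0.
Qed.

(* An antiderivative of Itot, see [is_derive_Iprim] and [Itot_E]. *)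
Definition Iprim t : R := expR (- t) * Ew (expR (- t)) H' - Ew (expR (- t)) H.

Lemma is_derive_Iprim t : is_derive t (1 : R) Iprim
  (- (expR (- t) ^+ 2 * Ew (expR (- t)) H'')).
Proof.
have h1 := is_derive_Ew_expRN t H; have h2 := is_derive_Ew_expRN t H'.
by rewrite /Iprim; apply: is_derive_eq; rewrite /GRing.scale /=; ring.
Qed.

Lemma integral_Itot (s t : R) : 0 < s -> s < t ->
  (\int[lebesgue_measure]_(u in `[s, t]%classic) (Itot q0 u)%:E
   = (Iprim t - Iprim s)%:E)%E.
Proof.
move=> s0 st.
(* The integrand is replaced by its closed form, whose continuity follows from differentiability. *)
transitivity (\int[lebesgue_measure]_(u in `[s, t]%classic)
    (- (expR (- u) ^+ 2 * Ew (expR (- u)) H''))%:E)%E.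
  apply: eq_integral => u; rewrite inE /= in_itv /= => /andP[su _].
  by rewrite Itot_E // (lt_le_trans s0).
have cIprim u : {for u, continuous Iprim}.
  by apply: differentiable_continuous; apply/derivable1_diffP; case: (is_derive_Iprim u).
rewrite EFinB; apply: continuous_FTC2 => //.
- apply: derivable_within_continuous => u _.
  by have h2 := is_derive_Ew_expRN u H''; apply: ex_derive.
- split; first by move=> u _; case: (is_derive_Iprim u).
    by apply: cvg_at_right_filter; exact: cIprim.
  by apply: cvg_at_left_filter; exact: cIprim.
- by move=> u _; rewrite derive1E; case: (is_derive_Iprim u).
Qed.

Lemma total_correlation_le (s h : R) : 0 < s -> 0 < h ->
  Ew (expR (- (s + h))) H - Ew (expR (- s)) H
    + (expR (- s) - expR (- (s + h))) * Ew (expR (- (s + h))) H'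
  <= (expR h - 1) * (Iprim (s + h) - Iprim s).
Proof.
move=> s0 h0; rewrite /Iprim; set x0 := expR (- (s + h)); set x1 := expR (- s).
have x1E : x1 = x0 * expR h by rewrite /x0 /x1 -expRD; congr expR; ring.
have x00 : 0 < x0 := expR_gt0 _.
have x01 : x0 <= x1 by rewrite ler_expR; lra.
have /andP[_ x11] : 0 < x1 < 1 := expRN_lt1 s0.
have conc : Ew x0 H <= Ew x1 H + Ew x1 H' * (x0 - x1).
  apply: (@concave_tangent _ (fun x => Ew x H) (fun x => Ew x H') (fun x => Ew x H'')) => //.
  - by move=> x _; exact: is_derive_Ew.
  - by move=> x _; exact: is_derive_Ew.
  - move=> x /andP[xx0 xx1]; rewrite -oppr_ge0 -EwN Ew_ge0 // => [|V].
      by rewrite (le_trans (ltW x00)) // (le_trans xx1) // ltW.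
    by rewrite oppr_ge0 DelT2_ent_le0.
have e1 : expR h - 1 = (x1 - x0) / x0 by rewrite x1E; field; rewrite gt_eqF.
rewrite e1 mulrAC ler_pdivlMr // -subr_ge0.
set f0 := Ew x0 H in conc *; set f1 := Ew x1 H in conc *.
set g0 := Ew x0 H'; set g1 := Ew x1 H' in conc *.
(* Once multiplied by [x0], the gap between the two sides is [x1] times the gap in the tangent
   inequality [conc]. *)
have -> : (x1 - x0) * (x0 * g0 - f0 - (x1 * g1 - f1)) - (f0 - f1 + (x1 - x0) * g0) * x0
  = x1 * (f1 + g1 * (x0 - x1) - f0) by ring.
by rewrite mulr_ge0 ?subr_ge0 // expR_ge0.
Qed.

Lemma Iprim_le (s t : R) : 0 < s -> s <= t -> Iprim s <= Iprim t.
Proof.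
move=> s0 st; apply: (ge0_is_derive_le st (fun u _ => is_derive_Iprim u)).
by move=> u /andP[su _]; rewrite -Itot_E ?Itot_ge0 // (lt_le_trans s0).
Qed.

End TotalCorrelation.

(** * The recursive bound for one step *)

Section OneStep.
Variables (R : realType) (S d : nat) (q0 : clean S d -> R).
Hypothesis q0_ge0 : forall z, 0 <= q0 z.
Hypothesis q0_sum : \sum_z q0 z = 1.

Lemma L_SE_ge0 (t : R) sh : 0 < t -> (forall y x, 0 < sh y x) -> 0 <= L_SE q0 t sh.
Proof.
move=> t0 sh0; have /andP[p0 p1] := expRN_lt1 t0.
rewrite L_SE_E //; apply: sumr_ge0 => z _; rewrite mulr_ge0 // Ew_ge0 ?ltW // => V.
apply: sumr_ge0 => i _; apply: sumr_ge0 => b _; apply: sD_ge0 => //.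
by rewrite mulr_ge0 ?cmar_ge0 // divr_ge0 ?ltW // subr_gt0.
Qed.

Lemma mul_expR_odds_le1 (t : R) : 0 < t -> expR (- t) / (1 - expR (- t)) * t <= 1.
Proof.
move=> t0; have /andP[p0 p1] := expRN_lt1 t0.
rewrite mulrAC ler_pdivrMr ?mul1r ?subr_gt0 // lerBrDl.
rewrite -[X in X + _]mulr1 -mulrDr expRN mulrC ler_pdivrMr ?expR_gt0 // mul1r.
exact: expR_ge1Dx.
Qed.

Lemma KLr_step (s h kappa G : R) (sh : state S d -> state S d -> R) (p : state S d -> R) :
  0 < s -> 0 < h -> h <= kappa * Num.min 1 s -> 0 <= kappa -> expR h <= G ->
  (forall y x, 0 < sh y x) -> (forall x, 0 < p x) ->
  KLr (qt q0 s) (fun y => \sum_x p x * Defs.kernel h sh x y)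
  <= KLr (qt q0 (s + h)) p + G * (h * (Iprim q0 (s + h) - Iprim q0 s))
     + h * L_SE q0 (s + h) sh
     + 2 * G ^+ 3 * (kappa * (h * abs_log_error q0 s h sh) + kappa ^+ 3 * d%:R).
Proof.
move=> s0 h0 hk k0 hG sh0 pos_p; have sh_gt0 : 0 < s + h by exact: addr_gt0.
have hk1 : h <= kappa.
  by apply: le_trans hk _; rewrite ler_piMr // ge_min lexx.
have hks : h <= kappa * s.
  by apply: le_trans hk _; rewrite ler_wpM2l // ge_min lexx orbT.
(* The bound [h <= kappa * s] enters here: the odds times [s] are at most the odds times [s + h],
   hence at most 1. *)
have ah : expR (- (s + h)) / (1 - expR (- (s + h))) * h <= kappa.
  have /andP[x0 x1] := expRN_lt1 sh_gt0.
  have a0 : 0 <= expR (- (s + h)) / (1 - expR (- (s + h))).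
    by rewrite divr_ge0 ?ltW // subr_gt0.
  have := mul_expR_odds_le1 sh_gt0; nra.
have -> : qt q0 s = fun y => \sum_x joint q0 s h x y.
  by apply/funext => y; rewrite sum_joint_l.
apply: le_trans (KLr_chain _ _ _ pos_p _) _.
- exact: joint_ge0.
- by move=> x y; exact: kernel_ge0.
- by move=> x y; exact: kernel_gt0_joint.
- by move=> x; rewrite sum_joint_r.
have : 0 <= Iprim q0 (s + h) - Iprim q0 s by rewrite subr_ge0 Iprim_le // lerDl ltW.
have := total_correlation_le q0_ge0 s0 h0.
move: (Iprim q0 (s + h) - Iprim q0 s) => I TC I0.
rewrite -!addrA lerD2l -/(path_cost q0 s h sh).
apply: le_trans (path_cost_le q0_ge0 q0_sum s0 h0 sh0 hk1 ah hG) _.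
rewrite -addrA lerD2r; apply: le_trans TC _.
rewrite mulrA; apply: (ler_wpM2r I0); apply: le_trans (expR_sub1_le h) _.
by rewrite (mulrC G) ler_wpM2l // ltW.
Qed.

End OneStep.

(** * Summation over the steps and choice of the constant *)

Theorem theorem4 (R : realType) (c0 : R) : 0 < c0 ->
  exists C : R, 0 < C /\
  forall (S d : nat) (q0 : clean S d -> R) (delta T kappa eps : R) (N : nat)
         (t : nat -> R) (shat : nat -> state S d -> state S d -> R),
    (forall x, 0 <= q0 x) -> \sum_(x : clean S d) q0 x = 1 ->
    0 < delta -> delta < T ->
    t 0%N = 0 -> (forall k, (k < N)%N -> t k < t k.+1) -> t N = T - delta ->
    (forall k, (0 < k <= N)%N ->
       t k - t k.-1 <= kappa * Num.min 1 (T - t k)) ->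
    kappa <= c0 ->
    (forall k, (k < N)%N -> forall y x, 0 < shat k y x) ->
    \sum_(k < N) (t k.+1 - t k) * L_SE q0 (T - t k) (shat k) <= eps ->
    (KL (qt q0 delta) (plaw T t shat N) <=
       C%:E * (eps%:E + (expR (- T) * d%:R * ln S%:R)%:E
               + \sum_(k < N) ((t k.+1 - t k)%:E *
                    \int[lebesgue_measure]_(u in `[(T - t k.+1)%R, (T - t k)%R]%classic)
                       (Itot q0 u)%:E)
               + (kappa ^+ 3 * N%:R * d%:R)%:E
               + (kappa * Cterm q0 T t shat N)%:E))%E.
Proof.
(* Every step has length at most [kappa <= c0], so [G] bounds each [expR h]; the constant is the one
   in [KLr_step], which also dominates 1 and [G]. *)
move=> c00; pose G := expR c0; exists (2 * G ^+ 3).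
have G1 : 1 <= G by rewrite -expR0 ler_expR ltW.
have G3 : G <= G ^+ 3 by rewrite exprS ler_peMr ?expr_ge1 //; lra.
split; first by lra.
move=> S d q0 delta T kappa eps N t shat q0_ge0 q0_sum delta0 deltaT t0 tS tN hk kc0 sh0 heps.
have tmon k l : (k <= l)%N -> (l <= N)%N -> t k <= t l.
  elim: l => [|l IH]; first by rewrite leqn0 => /eqP ->.
  rewrite leq_eqVlt => /predU1P[->//|kl lN].
  by apply: le_trans (IH kl (ltnW lN)) _; exact/ltW/tS.
have tT k : (k <= N)%N -> 0 < T - t k.
  by move=> kN; have := tmon k N kN (leqnn N); rewrite tN; lra.
have T0 : 0 < T by lra.
have step k : (k < N)%N -> 0 < t k.+1 - t k by move=> /tS; rewrite subr_gt0.
have stepk k : (k < N)%N -> t k.+1 - t k <= kappa * Num.min 1 (T - t k.+1).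
  by move=> kN; apply: (hk k.+1).
(* The first step has positive length, bounded by [kappa] times a positive minimum. It exists
   because [N = 0] would give [T - delta = 0]. *)
have k0 : 0 <= kappa.
  have N0 : (0 < N)%N by case: N tN {tmon tT step stepk hk tS sh0 heps} => //; lra.
  have := step _ N0; have := stepk _ N0.
  have : 0 < Num.min 1 (T - t 1%N) by rewrite lt_min ltr01 tT.
  by case: (lerP 0 kappa) => // kn m0 h1 h2; nra.
have eh k : (k < N)%N -> expR (t k.+1 - t k) <= G.
  move=> kN; rewrite ler_expR; apply: le_trans kc0; apply: le_trans (stepk _ kN) _.
  by rewrite ler_piMr // ge_min lexx.
have tE k : T - t k = T - t k.+1 + (t k.+1 - t k) by ring.
have plaw_gt0 k : (k <= N)%N -> forall x, 0 < plaw T t shat k x.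
  elim: k => [_ x|k IH kN x] /=.
    apply: prodr_gt0 => i _; have /andP[p0 p1] := expRN_lt1 T0.
    case: (x i) => [b|]; last by rewrite subr_gt0.
    by rewrite divr_gt0 // ltr0n (leq_ltn_trans _ (ltn_ord b)).
  have kpos y y' : 0 <= Defs.kernel (t k.+1 - t k) (shat k) y y'.
    by apply: kernel_ge0 => //; [exact: step|exact: sh0].
  rewrite (bigD1 x) //= ltr_wpDr //.
    by apply: sumr_ge0 => y _; rewrite mulr_ge0 // ltW // IH // ltnW.
  rewrite mulr_gt0 ?IH ?(ltnW kN) //; apply: prodr_gt0 => i _.
  by rewrite /step1; case: (x i) => [b|]; rewrite ?eqxx ?expR_gt0.
pose Ip k := Iprim q0 (T - t k) - Iprim q0 (T - t k.+1).
(* What [KLr_step] charges to step [k], with [abs_log_error] written out so that the sum produces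
   [Cterm]. *)
pose B k := G * ((t k.+1 - t k) * Ip k) + (t k.+1 - t k) * L_SE q0 (T - t k) (shat k)
  + 2 * G ^+ 3 * (kappa * ((t k.+1 - t k) *
      \sum_(x : state S d) qt q0 (T - t k) x *
      \sum_(i in masked x) \sum_(c : 'I_S)
        score q0 (T - t k) (setc x i (Some c)) x *
        `| ln (shat k (setc x i (Some c)) x /
               score q0 (T - t k) (setc x i (Some c)) x) |) + kappa ^+ 3 * d%:R).
have chain k : (k <= N)%N -> KLr (qt q0 (T - t k)) (plaw T t shat k)
    <= expR (- T) * d%:R * ln S%:R + \sum_(j < k) B j.
  elim: k => [_|k IH kN].
    by rewrite big_ord0 addr0 t0 subr0; exact: KLr_initial_le.
  rewrite big_ord_recr /= addrA.
  have := KLr_step q0_ge0 q0_sum (tT _ kN) (step _ kN) (stepk _ kN) k0 (eh _ kN)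
    (sh0 _ kN) (plaw_gt0 _ (ltnW kN)).
  rewrite /abs_log_error -!tE => /le_trans; apply.
  have := IH (ltnW kN); set E := _ + \sum_(j < k) _; rewrite /B /Ip; lra.
(* The output law is positive everywhere, so the infinite branch of [KL] does not occur. *)
have -> : KL (qt q0 delta) (plaw T t shat N) = (KLr (qt q0 delta) (plaw T t shat N))%:E.
  rewrite /KL ifN //; apply/fintype.existsPn => x.
  by rewrite negb_and orbC gt_eqF // plaw_gt0.
have -> : (\sum_(k < N) ((t k.+1 - t k)%:E *
      \int[lebesgue_measure]_(u in `[(T - t k.+1)%R, (T - t k)%R]%classic)
         (Itot q0 u)%:E) = (\sum_(k < N) (t k.+1 - t k) * Ip k)%:E)%E.
  rewrite -sumEFin; apply: eq_bigr => k _.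
  rewrite integral_Itot ?tT // ltrD2l ltrN2; exact: tS.
rewrite -!EFinD -EFinM lee_fin.
have := chain N (leqnn N); rewrite tN (_ : T - (T - delta) = delta); last by ring.
move=> /le_trans; apply.
have lS : 0 <= ln (S%:R : R).
  (* For [S = 0] the logarithm takes its default value 0. *)
  by case: (S) => [|n]; [rewrite ln0|apply: ln_ge0; rewrite ler1n].
have init0 : 0 <= expR (- T) * d%:R * ln S%:R by rewrite !mulr_ge0 ?expR_ge0.
have Ip0 : 0 <= \sum_(k < N) (t k.+1 - t k) * Ip k.
  apply: sumr_ge0 => k _; apply: mulr_ge0; first exact/ltW/step.
  by rewrite subr_ge0 Iprim_le ?tT // lerD2l lerN2 ltW // tS.
have L0 : 0 <= \sum_(k < N) (t k.+1 - t k) * L_SE q0 (T - t k) (shat k).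
  apply: sumr_ge0 => k _; apply: mulr_ge0; first exact/ltW/step.
  by apply: L_SE_ge0 => //; [apply: tT; exact: ltnW|exact: sh0].
have -> : \sum_(j < N) B j = G * (\sum_(k < N) (t k.+1 - t k) * Ip k)
   + \sum_(k < N) (t k.+1 - t k) * L_SE q0 (T - t k) (shat k)
   + 2 * G ^+ 3 * (kappa * Cterm q0 T t shat N + kappa ^+ 3 * N%:R * d%:R).
  rewrite /B big_split big_split /= -mulr_sumr; congr (_ + _).
  rewrite -mulr_sumr; congr (_ * _); rewrite big_split /= -mulr_sumr; congr (_ + _).
  by rewrite sumr_const card_ord -[LHS]mulr_natr; ring.
set E1 := expR _ * _ * _ in init0 *; set E2 := \sum_(k < N) _ in Ip0 *.
set E3 := \sum_(k < N) _ in heps L0 *.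
have GG1 : 1 <= 2 * G ^+ 3 by lra.
have eps0 : 0 <= eps by apply: le_trans heps.
rewrite !mulrDr.
have h1 : E3 <= 2 * G ^+ 3 * eps by apply: le_trans heps _; rewrite ler_peMl.
have h2 : E1 <= 2 * G ^+ 3 * E1 by rewrite ler_peMl.
have h3 : G * E2 <= 2 * G ^+ 3 * E2 by rewrite ler_wpM2r //; lra.
lra.
Qed.
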